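(* Let $d=2$, let $\Omega\subset\mathbb{R}^2$ be a bounded Lipschitz polytope, and let $s\in[3,4]$. Let $\nu,\kappa\in C^{0,1}(\mathbb{R})$, with Lipschitz constants $\mathcal{L}_\nu,\mathcal{L}_\kappa$, satisfy $\nu_-\le\nu(r)\le\nu_+$ and $\kappa_-\le\kappa(r)\le\kappa_+$ for all $r\in\mathbb{R}$, with positive constants $\nu_\pm,\kappa_\pm$. Let $\mathbf{f}\in\mathbf{H}^{-1}(\Omega)$ and $g\in H^{-1}(\Omega)$. Assume that, for some $\varepsilon>0$, the discrete coupled problem (on a mesh $\mathscr{T}_h\in\mathbb{T}$) has a solution $(\mathbf{u}_{h1},\mathsf{p}_{h1},T_{h1})\in(\mathbf{W}^{1,2+\varepsilon}(\Omega)\cap\mathbf{X}_h)\times M_h\times(W^{1,2+\varepsilon}(\Omega)\cap Y_h)$ such that $$\frac{\mathcal{C}_N}{\nu_-^2}\|\mathbf{f}\|_{\mathbf{H}^{-1}(\Omega)}+\frac{\mathcal{L}_\nu\mathcal{C}_\varepsilon\mathcal{C}_{4\hookrightarrow2}^2\|g\|_{H^{-1}(\Omega)}\|\nabla\mathbf{u}_{h1}\|_{\mathbf{L}^{2+\varepsilon}(\Omega)}}{\nu_-\kappa_-\left(\kappa_--\mathcal{L}_\kappa\mathcal{C}_\varepsilon\|\nabla T_{h1}\|_{\mathbf{L}^{2+\varepsilon}(\Omega)}\right)}<1,\qquad\mathcal{L}_\kappa\mathcal{C}_\varepsilon\|\nabla T_{h1}\|_{\mathbf{L}^{2+\varepsilon}(\Omega)}<\kappa_-.$$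 Then the discrete coupled problem has no other solution $(\mathbf{u}_{h2},\mathsf{p}_{h2},T_{h2})\in\mathbf{X}_h\times M_h\times Y_h$.
   Context: Bold letters denote $\mathbb{R}^d$-valued functions and their spaces; $|\cdot|$ is the Euclidean norm. $L_0^2(\Omega)$ is the space of $L^2(\Omega)$ functions with zero mean. $H^{-1}(\Omega)$ and $\mathbf{H}^{-1}(\Omega)$ are the duals of $H_0^1(\Omega)$ and $\mathbf{H}_0^1(\Omega)$, with dual norms taken with respect to the norm $\|\nabla\cdot\|_{L^2(\Omega)}$. Meshes and spaces. $\mathbb{T}=\{\mathscr{T}_h\}_{h>0}$ is a shape-regular family of conforming partitions of $\bar\Omega$ into closed simplices $K$, refinements of an initial mesh $\mathscr{T}_0$, with $h=\max_K\mathrm{diam}(K)$. The pair $(\mathbf{X}_h,M_h)$ is one of: (1) Taylor--Hood: $\mathbf{X}_h=\{\mathbf{v}_h\in\mathbf{C}(\bar\Omega):\mathbf{v}_h|_K\in[\mathbb{P}_2(K)]^d\ \forall K\in\mathscr{T}_h\}\cap\mathbf{H}_0^1(\Omega)$, $M_h=\{\mathsf{q}_h\in L_0^2(\Omega)\cap C(\bar\Omega):\mathsf{q}_h|_K\in\mathbb{P}_1(K)\ \forall K\in\mathscr{T}_h\}$; (2) mini element: $\mathbf{X}_h=\{\mathbf{v}_h\in\mathbf{C}(\bar\Omega):\mathbf{v}_h|_K\in[\mathbb{P}_1(K)\oplus\mathbb{B}(K)]^d\ \forall K\in\mathscr{T}_h\}\cap\mathbf{H}_0^1(\Omega)$, with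 $\mathbb{B}(K)$ the span of a local bubble function on $K$, and the same $M_h$. It satisfies the uniform discrete inf-sup condition: with some $\tilde\beta>0$ independent of $h$, $\inf_{\mathsf{q}_h\in M_h\setminus\{0\}}\sup_{\mathbf{v}_h\in\mathbf{X}_h\setminus\{0\}}\frac{\int_\Omega\mathsf{q}_h\,\mathrm{div}\,\mathbf{v}_h\,\mathrm{d}x}{\|\nabla\mathbf{v}_h\|_{\mathbf{L}^2(\Omega)}\|\mathsf{q}_h\|_{L^2(\Omega)}}\ge\tilde\beta$. Further, $Y_h=\{S_h\in C(\bar\Omega):S_h|_K\in\mathbb{P}_{\mathfrak{r}}(K)\ \forall K\in\mathscr{T}_h\}\cap H_0^1(\Omega)$ with $\mathfrak{r}=2$ in case (1) and $\mathfrak{r}=1$ in case (2). Discrete coupled problem. Let $a_N(\mathbf{u};\mathbf{v},\mathbf{w})=\int_\Omega(\mathbf{u}\cdot\nabla)\mathbf{v}\cdot\mathbf{w}\,\mathrm{d}x$, $a_{SN}(\mathbf{u};\mathbf{v},\mathbf{w})=\frac12[a_N(\mathbf{u};\mathbf{v},\mathbf{w})-a_N(\mathbf{u};\mathbf{w},\mathbf{v})]$, $a_{ST}(\mathbf{v};T,S)=\frac12\int_\Omega((\mathbf{v}\cdot\nabla T)S-(\mathbf{v}\cdot\nabla S)T)\,\mathrm{d}x$. Find $(\mathbf{u}_h,\mathsf{p}_h,T_h)\in\mathbf{X}_h\times M_h\times Y_h$ such that for all $(\mathbf{v}_h,\mathsf{q}_h,S_h)\in\mathbf{X}_h\times M_h\times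 Y_h$ $$\int_\Omega(\nu(T_h)\nabla\mathbf{u}_h\cdot\nabla\mathbf{v}_h+\mathbf{u}_h\cdot\mathbf{v}_h)\,\mathrm{d}x+a_{SN}(\mathbf{u}_h;\mathbf{u}_h,\mathbf{v}_h)+\int_\Omega|\mathbf{u}_h|^{s-2}\mathbf{u}_h\cdot\mathbf{v}_h\,\mathrm{d}x-\int_\Omega\mathsf{p}_h\,\mathrm{div}\,\mathbf{v}_h\,\mathrm{d}x=\langle\mathbf{f},\mathbf{v}_h\rangle,$$ $$\int_\Omega\mathsf{q}_h\,\mathrm{div}\,\mathbf{u}_h\,\mathrm{d}x=0,\qquad\int_\Omega\kappa(T_h)\nabla T_h\cdot\nabla S_h\,\mathrm{d}x+a_{ST}(\mathbf{u}_h;T_h,S_h)=\langle g,S_h\rangle.$$ Constants. $\mathcal{C}_N>0$ is a constant such that $|a_N(\mathbf{u};\mathbf{v},\mathbf{w})|\le\mathcal{C}_N\|\nabla\mathbf{u}\|_{\mathbf{L}^2(\Omega)}\|\nabla\mathbf{v}\|_{\mathbf{L}^2(\Omega)}\|\nabla\mathbf{w}\|_{\mathbf{L}^2(\Omega)}$ on $[\mathbf{H}_0^1(\Omega)]^3$. $\mathcal{C}_{4\hookrightarrow2}$ is the best constant in $\|v\|_{L^4(\Omega)}\le\mathcal{C}_{4\hookrightarrow2}\|\nabla v\|_{\mathbf{L}^2(\Omega)}$ for $v\in H_0^1(\Omega)$ (same symbol for vector-valued functions). $\mathcal{C}_\varepsilon$ is the best constant in $\|v\|_{L^{2(2+\varepsilon)/\varepsilon}(\Omega)}\le\mathcal{C}_\varepsilon\|\nabla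 v\|_{\mathbf{L}^2(\Omega)}$ for $v\in H_0^1(\Omega)$. *)

(* Defs.v *)
From HB Require Import structures.
From mathcomp Require Import all_boot all_order all_algebra.
From mathcomp Require Import all_classical all_reals all_analysis.

Set Implicit Arguments.
Unset Strict Implicit.
Unset Printing Implicit Defensive.

Import Order.TTheory GRing.Theory Num.Theory.
Import numFieldNormedType.Exports.

Local Open Scope classical_set_scope.
Local Open Scope ring_scope.

(* A function on a domain is a total function on the plane, of which only the
   values on the domain (on its closure, for continuous functions) are
   significant; a vector field is the family of its two components. *)
Notation plane R := (R * R)%type.
Notation scalar_field R := (plane R -> R).
Notation vector_field R := ('I_2 -> plane R -> R).

Section Plane.
Context {R : realType}.

Definition leb2 :
    {measure set (measurableTypeR R * measurableTypeR R) -> \bar R} :=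
  (lebesgue_measure \x lebesgue_measure)%E.

Definition basis (i : 'I_2) : plane R := if i == ord0 then (1, 0) else (0, 1).

Definition enorm (a : 'I_2 -> R) : R := Num.sqrt (\sum_i a i ^+ 2).

Definition edist (x y : plane R) : R :=
  Num.sqrt ((x.1 - y.1) ^+ 2 + (x.2 - y.2) ^+ 2).

Definition hull (v : 'I_3 -> plane R) (A : {set 'I_3}) : set (plane R) :=
  [set x | exists l : 'I_3 -> R,
    [/\ forall i, 0 <= l i, forall i, i \notin A -> l i = 0,
        \sum_i l i = 1 & x = \sum_i l i *: v i]].

Definition affinely_independent (v : 'I_3 -> plane R) : Prop :=
  forall l : 'I_3 -> R, \sum_i l i = 0 -> \sum_i l i *: v i = 0 ->
    forall i, l i = 0.

Definition simplex (K : set (plane R)) : Prop :=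
  exists v, affinely_independent v /\ K = hull v [set: 'I_3].

(* The faces of a simplex are the hulls of subsets of its vertices; the empty
   subset gives the empty face. *)
Definition face (F K : set (plane R)) : Prop :=
  exists v A, [/\ affinely_independent v, K = hull v [set: 'I_3] & F = hull v A].

Definition conforming_mesh (Omega : set (plane R)) (T : set (set (plane R))) :=
  [/\ finite_set T,
      forall K, T K -> simplex K,
      \bigcup_(K in T) K = closure Omega &
      forall K K', T K -> T K' -> face (K `&` K') K /\ face (K `&` K') K'].

Definition refinement (T T0 : set (set (plane R))) : Prop :=
  forall K, T K -> exists2 K0, T0 K0 & K `<=` K0.

Definition diam (K : set (plane R)) : R :=
  sup [set edist x y | x in K & y in K].

Definition inball_diam (K : set (plane R)) : R :=
  sup [set r *+ 2 | r in [set r | 0 <= r /\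
         exists c, [set x | edist c x <= r] `<=` K]].

Definition shape_regular (TT : set (set (set (plane R)))) : Prop :=
  exists sigma : R, forall T K, TT T -> T K -> diam K <= sigma * inball_diam K.

Definition mesh_family (Omega : set (plane R)) (T0 : set (set (plane R)))
    (TT : set (set (set (plane R)))) : Prop :=
  [/\ conforming_mesh Omega T0,
      forall T, TT T -> conforming_mesh Omega T /\ refinement T T0 &
      shape_regular TT].

(* Near x0, in the orthonormal frame (t, n) with t = (c, d) and n = (-d, c),
   the set Omega is the strict subgraph of the Lipschitz function gamma. *)
Definition lipschitz_boundary (Omega : set (plane R)) : Prop :=
  forall x0, (closure Omega `\` Omega) x0 ->
    exists (c d rho eta L : R) (gamma : R -> R),
      [/\ c ^+ 2 + d ^+ 2 = 1, 0 < rho, 0 < eta, L.-lipschitz gamma &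
          forall a b, `|a| < rho -> `|b| < eta ->
            Omega (x0.1 + a * c - b * d, x0.2 + a * d + b * c) <->
              b < gamma a].

Definition polytope (Omega : set (plane R)) : Prop :=
  exists D : set (set (plane R)),
    [/\ finite_set D, forall K, D K -> simplex K &
        closure Omega = \bigcup_(K in D) K].

Definition bounded_lipschitz_polytope (Omega : set (plane R)) : Prop :=
  [/\ open Omega, bounded_set Omega, polytope Omega & lipschitz_boundary Omega].

Definition eLp_norm (Omega : set (plane R)) (p : R) (u : scalar_field R) :
    \bar R :=
  'N[leb2]_(p%:E)[EFin \o (u \_ Omega)]%E.

Definition Lp_norm Omega p u : R := fine (eLp_norm Omega p u).

Definition Lp (Omega : set (plane R)) (p : R) (u : scalar_field R) : Prop :=
  measurable_fun Omega u /\ (eLp_norm Omega p u < +oo)%E.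

Definition L1loc (Omega : set (plane R)) (u : scalar_field R) : Prop :=
  measurable_fun Omega u /\
  forall K, compact K -> K `<=` Omega -> leb2.-integrable K (EFin \o u).

Fixpoint Ck (k : nat) (phi : scalar_field R) : Prop :=
  continuous phi /\
  match k with
  | 0 => True
  | k'.+1 => forall i, (forall x, derivable phi x (basis i)) /\
                       Ck k' ('D_(basis i) phi)
  end.

Definition test_function (Omega : set (plane R)) (phi : scalar_field R) : Prop :=
  (forall k, Ck k phi) /\
  exists K, [/\ compact K, K `<=` Omega & forall x, ~ K x -> phi x = 0].

Definition is_weak_deriv (Omega : set (plane R)) (i : 'I_2)
    (u g : scalar_field R) : Prop :=
  [/\ L1loc Omega u, L1loc Omega g &
      forall phi, test_function Omega phi ->
        \int[leb2]_(x in Omega) (u x * 'D_(basis i) phi x) =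
        - \int[leb2]_(x in Omega) (g x * phi x)].

(* The weak derivative is determined almost everywhere on Omega; this is a
   choice of representative, and it is 0 when there is no weak derivative. *)
Definition wderiv (Omega : set (plane R)) (i : 'I_2) (u : scalar_field R) :
    scalar_field R :=
  xget (cst 0) [set g | is_weak_deriv Omega i u g].

Definition W1p (Omega : set (plane R)) (p : R) (u : scalar_field R) : Prop :=
  Lp Omega p u /\
  forall i, (exists g, is_weak_deriv Omega i u g) /\
            Lp Omega p (wderiv Omega i u).

Definition vW1p (Omega : set (plane R)) (p : R) (v : vector_field R) : Prop :=
  forall i, W1p Omega p (v i).

Definition grad_abs (Omega : set (plane R)) (u : scalar_field R) :
    scalar_field R :=
  fun x => enorm (fun j => wderiv Omega j u x).

Definition vgrad_abs (Omega : set (plane R)) (v : vector_field R) :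
    scalar_field R :=
  fun x => Num.sqrt (\sum_i \sum_j wderiv Omega j (v i) x ^+ 2).

Definition grad_norm Omega (p : R) (u : scalar_field R) : R :=
  Lp_norm Omega p (grad_abs Omega u).

Definition vgrad_norm Omega (p : R) (v : vector_field R) : R :=
  Lp_norm Omega p (vgrad_abs Omega v).

Definition div Omega (v : vector_field R) : scalar_field R :=
  fun x => \sum_i wderiv Omega i (v i) x.

Definition H1_norm Omega (u : scalar_field R) : R :=
  Num.sqrt (Lp_norm Omega 2 u ^+ 2 + grad_norm Omega 2 u ^+ 2).

Definition H10 (Omega : set (plane R)) (u : scalar_field R) : Prop :=
  W1p Omega 2 u /\
  forall e : R, 0 < e -> exists2 phi, test_function Omega phi &
    H1_norm Omega (fun x => u x - phi x) < e.

Definition vH10 (Omega : set (plane R)) (v : vector_field R) : Prop :=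
  forall i, H10 Omega (v i).

(* A functional is a total map on fields of which only the values on H10 are
   significant. *)
Definition Hm1 (Omega : set (plane R)) (F : scalar_field R -> R) : Prop :=
  (forall a u v, H10 Omega u -> H10 Omega v ->
     F (fun x => a * u x + v x) = a * F u + F v) /\
  exists C : R, forall v, H10 Omega v -> `|F v| <= C * grad_norm Omega 2 v.

Definition vHm1 (Omega : set (plane R)) (F : vector_field R -> R) : Prop :=
  (forall a u v, vH10 Omega u -> vH10 Omega v ->
     F (fun i x => a * u i x + v i x) = a * F u + F v) /\
  exists C : R, forall v, vH10 Omega v -> `|F v| <= C * vgrad_norm Omega 2 v.

Definition Hm1_norm (Omega : set (plane R)) (F : scalar_field R -> R) : R :=
  sup [set `|F v| / grad_norm Omega 2 v |
        v in [set v | H10 Omega v /\ grad_norm Omega 2 v != 0]].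

Definition vHm1_norm (Omega : set (plane R)) (F : vector_field R -> R) : R :=
  sup [set `|F v| / vgrad_norm Omega 2 v |
        v in [set v | vH10 Omega v /\ vgrad_norm Omega 2 v != 0]].

Definition poly_on (k : nat) (K : set (plane R)) (f : scalar_field R) : Prop :=
  exists c : nat -> nat -> R, forall x, K x ->
    f x = \sum_(i < k.+1) \sum_(j < k.+1 | (i + j <= k)%N)
            c i j * x.1 ^+ i * x.2 ^+ j.

Definition bubble (K : set (plane R)) (b : scalar_field R) : Prop :=
  [/\ {within K, continuous b}, H10 (interior K) b,
      forall x, (K `\` interior K) x -> b x = 0 &
      exists2 x, K x & b x != 0].

(* The parameter of Mini assigns to each simplex its local bubble function; no
   particular bubble (such as the product of the barycentric coordinates) is
   imposed. *)
Inductive fe_pair : Type :=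
| TaylorHood
| Mini of (set (plane R) -> scalar_field R).

Definition admissible_pair (fe : fe_pair) (TT : set (set (set (plane R)))) :=
  match fe with
  | TaylorHood => True
  | Mini b => forall T K, TT T -> T K -> bubble K (b K)
  end.

Definition local_velocity (fe : fe_pair) (K : set (plane R))
    (f : scalar_field R) : Prop :=
  match fe with
  | TaylorHood => poly_on 2 K f
  | Mini b => exists (p : scalar_field R) (c : R),
      poly_on 1 K p /\ forall x, K x -> f x = p x + c * b K x
  end.

Definition temperature_degree (fe : fe_pair) : nat :=
  match fe with TaylorHood => 2 | Mini _ => 1 end.

Definition Xh (fe : fe_pair) Omega (T : set (set (plane R)))
    (v : vector_field R) : Prop :=
  [/\ forall i, {within closure Omega, continuous (v i)},
      forall i K, T K -> local_velocity fe K (v i) & vH10 Omega v].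

Definition Mh Omega (T : set (set (plane R))) (q : scalar_field R) : Prop :=
  [/\ {within closure Omega, continuous q}, forall K, T K -> poly_on 1 K q,
      Lp Omega 2 q & \int[leb2]_(x in Omega) q x = 0].

Definition Yh (fe : fe_pair) Omega (T : set (set (plane R)))
    (S : scalar_field R) : Prop :=
  [/\ {within closure Omega, continuous S},
      forall K, T K -> poly_on (temperature_degree fe) K S & H10 Omega S].

Definition nonzero_on (A : set (plane R)) (q : scalar_field R) : Prop :=
  exists2 x, A x & q x != 0.

Definition inf_sup (beta : R) (fe : fe_pair) Omega T : Prop :=
  (beta%:E <= ereal_inf
    [set ereal_sup
      [set ((\int[leb2]_(x in Omega) (q x * div Omega v x)) /
            (vgrad_norm Omega 2 v * Lp_norm Omega 2 q))%:E |
        v in [set v | Xh fe Omega T v /\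
                      exists i, nonzero_on (closure Omega) (v i)]] |
      q in [set q | Mh Omega T q /\ nonzero_on (closure Omega) q]])%E.

Definition aN Omega (u v w : vector_field R) : R :=
  \int[leb2]_(x in Omega)
    (\sum_i (\sum_j u j x * wderiv Omega j (v i) x) * w i x).

Definition aSN Omega (u v w : vector_field R) : R :=
  2^-1 * (aN Omega u v w - aN Omega u w v).

Definition aST Omega (v : vector_field R) (T S : scalar_field R) : R :=
  2^-1 * \int[leb2]_(x in Omega)
    ((\sum_j v j x * wderiv Omega j T x) * S x -
     (\sum_j v j x * wderiv Omega j S x) * T x).

Definition discrete_solution (Omega : set (plane R)) (fe : fe_pair)
    (Th : set (set (plane R))) (s : R) (nu kappa : R -> R)
    (f : vector_field R -> R) (g : scalar_field R -> R)
    (u : vector_field R) (p T : scalar_field R) : Prop :=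
  [/\ Xh fe Omega Th u, Mh Omega Th p, Yh fe Omega Th T &
   [/\ forall v, Xh fe Omega Th v ->
        \int[leb2]_(x in Omega)
          (nu (T x) * (\sum_i \sum_j
             wderiv Omega j (u i) x * wderiv Omega j (v i) x) +
           \sum_i u i x * v i x) +
        aSN Omega u u v +
        \int[leb2]_(x in Omega)
          (enorm (u ^~ x) `^ (s - 2) * \sum_i u i x * v i x) -
        \int[leb2]_(x in Omega) (p x * div Omega v x) = f v,
      forall q, Mh Omega Th q ->
        \int[leb2]_(x in Omega) (q x * div Omega u x) = 0 &
      forall S, Yh fe Omega Th S ->
        \int[leb2]_(x in Omega)
          (kappa (T x) *
             \sum_j wderiv Omega j T x * wderiv Omega j S x) +
        aST Omega u T S = g S]].

Definition is_embedding_const (Omega : set (plane R)) (p C : R) : Prop :=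
  0 <= C /\
  forall v, H10 Omega v ->
    (eLp_norm Omega p v <= (C * grad_norm Omega 2 v)%:E)%E.

Definition is_best_embedding_const (Omega : set (plane R)) (p C : R) : Prop :=
  is_embedding_const Omega p C /\
  forall C', is_embedding_const Omega p C' -> C <= C'.

Definition is_convection_const (Omega : set (plane R)) (C : R) : Prop :=
  0 < C /\
  forall u v w, vH10 Omega u -> vH10 Omega v -> vH10 Omega w ->
    `|aN Omega u v w| <=
      C * vgrad_norm Omega 2 u * vgrad_norm Omega 2 v * vgrad_norm Omega 2 w.

End Plane.

Arguments fe_pair R : clear implicits.

(* Main.v *)
Require Import Defs.
From mathcomp Require Import all_boot all_order all_algebra.
From mathcomp Require Import all_classical all_reals all_analysis.
From mathcomp Require Import ring lra measurable_realfun.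

Set Implicit Arguments.
Unset Strict Implicit.
Unset Printing Implicit Defensive.

Import Order.TTheory GRing.Theory Num.Theory.
Import numFieldNormedType.Exports.

Local Open Scope classical_set_scope.
Local Open Scope ring_scope.

(** The proof is an energy argument for the differences [w] of the velocities and
    [t] of the temperatures of two solutions.

    Testing the two heat equations with [t] and subtracting, the skew symmetry of
    the convection form cancels the transport of [t] by the second velocity
    ([aSTB_skew]). What remains is a coercive diffusion term, the effect of the
    Lipschitz coefficient, which costs [Lkappa * Ceps * |grad T1|] times
    [|grad t|^2] ([lipschitz_coefficient_bound]), and the transport of [T1] by
    [w], which is bounded by the embedding into [L4] ([conv_bound]) and the a
    priori bound on [grad T1] ([temperature_apriori]). So [|grad t|] is at most a
    multiple of [|grad w|] ([temperature_difference]). The momentum equations are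
    treated in the same way with the test function [w] ([velocity_difference]):
    the pressures disappear because both velocities are discretely divergence
    free, and the zero-order and Forchheimer terms are monotone
    ([enorm_powR_monotone]). The smallness assumption then forces both gradients
    to vanish ([smallness_forces_zero]); since the embedding constants are finite,
    [w] and [t] vanish too ([eq0_of_grad_norm]). Finally, the difference of the
    pressures is orthogonal to all discrete divergences, so it vanishes by the
    inf-sup condition ([inf_sup_injective]).

    All of this uses that the weak derivatives of a difference are the differences
    of the weak derivatives. As [wderiv] picks representatives, this holds almost
    everywhere and rests on the uniqueness of weak derivatives, that is, on the
    fundamental lemma of the calculus of variations ([fundamental_lemma]): smooth
    bumps converge to indicators of boxes, and boxes generate the measurable sets.
    That [H10] is stable under differences moreover needs that test functions have
    their classical derivatives as weak derivatives ([is_weak_deriv_test]). *)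

(** * Boxes and Lebesgue measure on the plane *)

(** The plane with the product of the Borel sigma-algebras, on which [leb2] is
    defined. *)
Notation mplane R := (measurableTypeR R * measurableTypeR R)%type.

Section PlaneTopology.
Context {R : realType}.
Implicit Types (A K : set (plane R)) (f : scalar_field R).

(** Rational boxes around the points suffice. The closed boxes are required to
    lie in [A], so that functions supported in them can be used as test
    functions on [A]. *)
Lemma open_bigcup_box A : open A -> exists a b c d : nat -> R,
  (forall n, `[a n, b n] `*` `[c n, d n] `<=` A) /\
  A = \bigcup_n (`]a n, b n[ `*` `]c n, d n[).
Proof.
move=> oA.
pose box (q : rat * rat * rat * rat) : set (plane R) :=
  `[ratr q.1.1.1, ratr q.1.1.2] `*` `[ratr q.1.2, ratr q.2].
(* The default (1, 0, 1, 0) stands for the empty box. *)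
pose F n : rat * rat * rat * rat :=
  if unpickle n is Some q then
    if `[< box q `<=` A >] then q else (1, 0, 1, 0) else (1, 0, 1, 0).
have FA n : box (F n) `<=` A.
  have e0 : box (1, 0, 1, 0) `<=` A.
    move=> [x y] [/= +_]; rewrite in_itv/= rmorph1 rmorph0 => /andP[h1 h2].
    by have := le_trans h1 h2; rewrite ler10.
  by rewrite /F; case: unpickle => // q; case: asboolP.
exists (fun n => ratr (F n).1.1.1), (fun n => ratr (F n).1.1.2),
  (fun n => ratr (F n).1.2), (fun n => ratr (F n).2); split => //.
apply/seteqP; split => [x Ax|x [n _ [/= x1 x2]]]; last first.
  by apply: (FA n); split => /=; apply: subset_itv_oo_cc.
have /nbhs_ballP[e /= e0 eA] : nbhs x A by exact: open_nbhs_nbhs.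
have [a] : exists q : rat, ratr q \in `]x.1 - e, x.1[.
  by apply: rat_in_itvoo; rewrite gtrBl.
have [b] : exists q : rat, ratr q \in `]x.1, x.1 + e[.
  by apply: rat_in_itvoo; rewrite ltrDl.
have [c] : exists q : rat, ratr q \in `]x.2 - e, x.2[.
  by apply: rat_in_itvoo; rewrite gtrBl.
have [d] : exists q : rat, ratr q \in `]x.2, x.2 + e[.
  by apply: rat_in_itvoo; rewrite ltrDl.
rewrite !in_itv/= => /andP[d1 d2] /andP[c1 c2] /andP[b1 b2] /andP[a1 a2].
have sub : box (a, b, c, d) `<=` A.
  move=> y [/=]; rewrite !in_itv/= => /andP[h1 h2] /andP[h3 h4].
  apply: eA; split; rewrite /ball/= ltr_distlC.
    by rewrite (lt_le_trans a1 h1) (le_lt_trans h2 b2).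
  by rewrite (lt_le_trans c1 h3) (le_lt_trans h4 d2).
exists (pickle (a, b, c, d)) => //.
rewrite /F pickleK; case: asboolP => // _ /=.
by split => /=; rewrite in_itv/= ?a2 ?b1 ?c2 ?d1.
Qed.

Lemma measurable_box a b c d : measurable (`]a, b[ `*` `]c, d[ : set (mplane R)).
Proof. by apply: measurableX; exact: measurable_itv. Qed.

Lemma measurable_cbox a b c d : measurable (`[a, b] `*` `[c, d] : set (mplane R)).
Proof. by apply: measurableX; exact: measurable_itv. Qed.

Lemma open_measurable_plane A : open A -> measurable (A : set (mplane R)).
Proof.
move=> /open_bigcup_box[a [b [c [d [_ ->]]]]].
by apply: bigcupT_measurable => n; exact: measurable_box.
Qed.

Lemma closed_measurable_plane A : closed A -> measurable (A : set (mplane R)).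
Proof.
move=> cA; rewrite -(setCK A); apply: measurableC.
by apply: open_measurable_plane; rewrite openC.
Qed.

Lemma compact_measurable_plane K : compact K -> measurable (K : set (mplane R)).
Proof.
move=> cK; apply: closed_measurable_plane; apply: compact_closed => //.
Qed.

Lemma continuous_measurable_plane f :
  continuous f -> measurable_fun setT (f : mplane R -> R).
Proof.
move=> cf; apply: (measurability _ (RGenOpens.measurableE R)) => _ [_ [a [b ->] <-]].
rewrite setTI; apply: open_measurable_plane; move: cf => /continuousP; apply; exact: interval_open.
Qed.

Lemma bounded_sub_cbox A : bounded_set A ->
  exists M : R, A `<=` `[- M, M] `*` `[- M, M].
Proof.
move=> [M [_ hM]]; exists (M + 1) => x Ax.
have := hM (M + 1) _ x Ax; rewrite ltrDl ltr01 => /(_ isT).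
rewrite /= prod_normE/= ge_max => /andP[h1 h2].
by split => /=; rewrite in_itv/= -ler_norml.
Qed.

Lemma leb2X (A B : set (measurableTypeR R)) : measurable A -> measurable B ->
  leb2 (A `*` B) = (lebesgue_measure A * lebesgue_measure B)%E.
Proof. exact: product_measure1E. Qed.

Lemma leb2_box a b c d : a <= b -> c <= d ->
  leb2 (`]a, b[ `*` `]c, d[) = ((b - a) * (d - c))%:E :> \bar R.
Proof.
move=> ab cd; rewrite leb2X; [|exact: measurable_itv|exact: measurable_itv].
rewrite EFinM; congr (_ * _)%E.
  rewrite lebesgue_measure_itv/= lte_fin EFinB.
  by case: ltgtP ab => // -> _; rewrite subee.
rewrite lebesgue_measure_itv/= lte_fin EFinB.
by case: ltgtP cd => // -> _; rewrite subee.
Qed.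

Lemma leb2_cbox_lty a b c d :
  (leb2 (`[a, b] `*` `[c, d]) < +oo :> \bar R)%E.
Proof.
rewrite leb2X; [|exact: measurable_itv|exact: measurable_itv].
by rewrite !lebesgue_measure_itv/= -!EFinB; do 2 case: ifPn => _;
  rewrite ?mul0e ?mule0 ?ltry// -EFinM ltry.
Qed.

Lemma bounded_leb2_lty A : measurable (A : set (mplane R)) -> bounded_set A ->
  (leb2 A < +oo)%E.
Proof.
move=> mA /bounded_sub_cbox[M AM].
apply: le_lt_trans (leb2_cbox_lty (- M) M (- M) M).
by apply: le_measure => //; rewrite inE//; exact: measurable_cbox.
Qed.

Lemma compact_cbox a b c d : compact (`[a, b] `*` `[c, d] : set (plane R)).
Proof. by apply: compact_setX; exact: segment_compact. Qed.

Lemma compact_closure_bounded A : bounded_set A -> compact (closure A).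
Proof.
move=> /bounded_sub_cbox[M AM]; apply: subclosed_compact (@compact_cbox (- M) M (- M) M) _.
  exact: closed_closure.
have /closure_id -> : closed (`[- M, M] `*` `[- M, M] : set (plane R)); last first.
  exact: closure_subset.
by apply: compact_closed; [exact: norm_hausdorff|exact: compact_cbox].
Qed.

Lemma open_leb2_gt0 A : open A -> A !=set0 -> (0 < leb2 A)%E.
Proof.
move=> oA [x Ax]; have [a [b [c [d [subA AE]]]]] := open_bigcup_box oA.
move: (Ax); rewrite {1}AE => -[n _ [/= x1 x2]].
have sub : `]a n, b n[ `*` `]c n, d n[ `<=` A by rewrite AE => y hy; exists n.
move: x1 x2; rewrite !in_itv/= => /andP[/lt_trans h1 /h1 ab] /andP[/lt_trans h2 /h2 cd].
have : (leb2 (`]a n, b n[ `*` `]c n, d n[) <= leb2 A)%E.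
  apply: le_measure => //; rewrite inE; [exact: measurable_box|exact: open_measurable_plane].
apply: lt_le_trans; rewrite leb2_box ?ltW// lte_fin mulr_gt0// subr_gt0//.
Qed.

(** Nonempty open sets have positive measure, so an almost sure property of the
    points of [A] holds on a dense subset of [closure A]. *)
Lemma ae_eq0_closure A f : open A -> {within closure A, continuous f} ->
  (\forall x \ae leb2, A x -> f x = 0) -> forall x, closure A x -> f x = 0.
Proof.
move=> oA cf f0 x cAx; apply/eqP; rewrite -normr_eq0 eq_le normr_ge0 andbT.
apply/ler_addgt0Pl => e e0; rewrite addr0.
have /cvgrPdist_lt/(_ e e0) := cf x.
rewrite {1}/nbhs/= -nbhs_subspace_in// => /nbhs_interior; rewrite nbhsE/= => -[U [oU Ux] hU].
have [y [Ay Uy]] : A `&` U !=set0 by apply: cAx; exact: open_nbhs_nbhs.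
have oAU : open (A `&` U) by exact: openI.
have AU0 : (0 < leb2 (A `&` U))%E by apply: open_leb2_gt0 => //; exists y.
have [z [[Az Uz] fz]] : exists z, (A `&` U) z /\ f z = 0.
  apply: contrapT => /forallNP nz.
  have : leb2.-negligible (A `&` U).
    apply: negligibleS f0 => z AUz /= h; apply: (nz z); split => //; exact/h/AUz.1.
  move/negligibleP => /(_ (open_measurable_plane oAU)) AU.
  by rewrite AU ltxx in AU0.
have := interior_subset (hU z Uz) (subset_closure Az).
by rewrite /from_subspace fz subr0 => /ltW.
Qed.

Definition boxes : set_system (mplane R) :=
  [set X | exists a b c d : R, X = `]a, b[ `*` `]c, d[].

Lemma boxI a b c d a' b' c' d' :
  (`]a, b[ `*` `]c, d[) `&` (`]a', b'[ `*` `]c', d'[) =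
  (`]Num.max a a', Num.min b b'[ `*` `]Num.max c c', Num.min d d'[ : set (plane R)).
Proof.
apply/seteqP; split => [[x y]|[x y]] /=; rewrite !in_itv/= !gt_max !lt_min.
  by move=> [[/andP[-> ->] /andP[-> ->]] [/andP[-> ->] /andP[-> ->]]].
by move=> [/andP[/andP[-> ->] /andP[-> ->]] /andP[/andP[-> ->] /andP[-> ->]]].
Qed.

Lemma setI_closed_boxes : setI_closed boxes.
Proof.
move=> _ _ [a [b [c [d ->]]]] [a' [b' [c' [d' ->]]]].
by rewrite boxI; exists (Num.max a a'), (Num.min b b'), (Num.max c c'), (Num.min d d').
Qed.

(** A strip over a half-open interval is a countable intersection of countable
    unions of open boxes, and these strips generate the product
    sigma-algebra. *)
Lemma measurable_boxes : @measurable _ (mplane R) = <<s boxes >>.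
Proof.
apply/seteqP; split; last first.
  apply: smallest_sub; first exact: smallest_sigma_algebra.
  by move=> _ [a [b [c [d ->]]]]; exact: measurable_box.
have bbox a b c d : <<s boxes >> (`]a, b[ `*` `]c, d[).
  by apply: sub_sigma_algebra; exists a, b, c, d.
have sU (F : nat -> set (mplane R)) : (forall n, <<s boxes >> (F n)) -> <<s boxes >> (\bigcup_n F n).
  by move=> hF; apply: sigma_algebra_bigcup => i; exact: hF.
have sI (F : nat -> set (mplane R)) : (forall n, <<s boxes >> (F n)) -> <<s boxes >> (\bigcap_n F n).
  move=> hF; rewrite -(setCK (\bigcap_n F n)) setC_bigcap.
  by apply: sigma_algebraC; apply: sU => n; apply: sigma_algebraC.
have itvT (k : nat) (x : R) : `|x| < k%:R -> x \in `]- k%:R, k%:R[ by rewrite in_itv/= ltr_norml.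
have big (x : R) : exists k : nat, `|x| < k%:R.
  by exists (Num.truncn `|x|).+1; exact: truncnS_gt.
have sL (A : set (measurableTypeR R)) : measurable A -> <<s boxes >> (A `*` setT).
  apply: (@smallest_sub _ _ _ [set A : set (measurableTypeR R) | <<s boxes >> (A `*` setT)]).
    split => [|B/=|F/=] .
    - rewrite /= set0X; exact: sigma_algebra0.
    - by move=> /sigma_algebraC; congr (<<s _ >> _); apply/seteqP; split => -[x y]/=; tauto.
    - by move=> /sU; congr (<<s _ >> _); apply/seteqP; split => -[x y]/=; [move=> [n _ [? _]]; split => //; exists n|move=> [[n _ ?] _]; exists n].
  move=> _ [[a b] _ <-]/=.
  rewrite (_ : _ `*` _ = \bigcap_n \bigcup_k (`]a, b + n.+1%:R^-1[ `*` `]- k%:R, k%:R[)).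
    by apply: sI => n; apply: sU => k.
  apply/seteqP; split => [[x y] [/=]|[x y] h/=].
    rewrite in_itv/= => /andP[ax xb] _ n _; have [k yk] := big y.
    exists k => //; split => /=; last exact: itvT.
    by rewrite in_itv/= ax/= (le_lt_trans xb)// ltrDl invr_gt0.
  split => //; rewrite in_itv/=; have [k _ [/=]] := h 0%N I; rewrite in_itv/= => /andP[-> _] _ /=.
  rewrite leNgt; apply/negP => /ltr_add_invr[n bn].
  have [m _ [/=]] := h n I; rewrite in_itv/= => /andP[_ +] _.
  by rewrite ltNge (ltW bn).
have sR (A : set (measurableTypeR R)) : measurable A -> <<s boxes >> (setT `*` A).
  apply: (@smallest_sub _ _ _ [set A : set (measurableTypeR R) | <<s boxes >> (setT `*` A)]).
    split => [|B/=|F/=] .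
    - rewrite /= setX0; exact: sigma_algebra0.
    - by move=> /sigma_algebraC; congr (<<s _ >> _); apply/seteqP; split => -[x y]/=; tauto.
    - by move=> /sU; congr (<<s _ >> _); apply/seteqP; split => -[x y]/=; [move=> [n _ [_ ?]]; split => //; exists n|move=> [_ [n _ ?]]; exists n].
  move=> _ [[a b] _ <-]/=.
  rewrite (_ : _ `*` _ = \bigcap_n \bigcup_k (`]- k%:R, k%:R[ `*` `]a, b + n.+1%:R^-1[)).
    by apply: sI => n; apply: sU => k.
  apply/seteqP; split => [[y x] [/=]|[y x] h/=].
    rewrite in_itv/= => _ /andP[ax xb] n _; have [k yk] := big y.
    exists k => //; split => /=; first exact: itvT.
    by rewrite in_itv/= ax/= (le_lt_trans xb)// ltrDl invr_gt0.
  split => //; rewrite in_itv/=; have [k _ [/= _]] := h 0%N I; rewrite in_itv/= => /andP[-> _] /=.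
  rewrite leNgt; apply/negP => /ltr_add_invr[n bn].
  have [m _ [/= _]] := h n I; rewrite in_itv/= => /andP[_].
  by rewrite ltNge (ltW bn).
rewrite measurable_prod_measurableType; apply: smallest_sub; first exact: smallest_sigma_algebra.
move=> _ [A mA] [B mB] <-; rewrite -[A]setIT -[B]setTI setXI -bigcap2E.
have sT : <<s boxes >> setT by have := sL _ (@measurableT _ (measurableTypeR R)); rewrite setXTT.
by apply: sI => -[|[|n]] //=; [exact: sL|exact: sR].
Qed.

End PlaneTopology.

(** * Smooth bump functions *)

Section FlatExponential.
Context {R : realType}.
Implicit Types (P : {poly R}) (t : R).

(** The functions [P(1/t) exp(-1/t)], extended by 0 to the left of 0. The factor
    [P] makes the class stable under differentiation, so that all its members
    are smooth. *)
Definition flat_exp P t : R := if 0 < t then P.[t^-1] * expR (- t^-1) else 0.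

(** The exponential series dominates each monomial: [s^n <= n! exp s]. *)
Lemma horner_expRN_bounded P :
  exists C : R, 0 <= C /\ forall s, 0 <= s -> `|P.[s]| * expR (- s) <= C.
Proof.
have mon (n : nat) (s : R) : 0 <= s -> s ^+ n * expR (- s) <= n`!%:R.
  move=> s0; rewrite expRN ler_pdivrMr ?expR_gt0//.
  case: n => [|n]; first by rewrite expr0 fact0 mul1r (le_trans _ (expR_ge1Dx s))// lerDl.
  rewrite mulrC -ler_pdivrMr ?ltr0n ?fact_gt0//.
  by apply: le_trans (expR_ge1Dxn n s0); rewrite lerDr.
exists (\sum_(i < size P) `|P`_i| * i`!%:R); split.
  by apply: sumr_ge0 => i _; rewrite mulr_ge0.
move=> s s0; rewrite horner_coef.
apply: (@le_trans _ _ ((\sum_(i < size P) `|P`_i| * s ^+ i) * expR (- s))).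
  rewrite ler_wpM2r ?expR_ge0//; apply: le_trans (ler_norm_sum _ _ _) _.
  by apply: ler_sum => i _; rewrite normrM (ger0_norm (exprn_ge0 _ s0)).
rewrite mulr_suml; apply: ler_sum => i _.
by rewrite -mulrA ler_wpM2l// mon.
Qed.

Lemma flat_exp_le_sqr P :
  exists C : R, 0 <= C /\ forall t, `|flat_exp P t| <= C * t ^+ 2.
Proof.
have [C [C0 hC]] := horner_expRN_bounded (P * 'X^2).
exists C; split => // t; rewrite /flat_exp; case: ifPn => [t0|_]; last first.
  by rewrite normr0 mulr_ge0// sqr_ge0.
have ti : 0 <= t^-1 by rewrite invr_ge0 ltW.
have := hC t^-1 ti.
rewrite hornerM hornerXn normrM (ger0_norm (exprn_ge0 _ ti)).
by rewrite [in X in _ -> X]normrM (ger0_norm (expR_ge0 _)) exprVn mulrAC ler_pdivrMr ?exprn_gt0.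
Qed.

(** Away from 0 this is the chain rule; at 0 the difference quotient is
    [O(t)] by the quadratic bound. *)
Lemma is_derive_flat_exp P t :
  is_derive t 1 (flat_exp P) (flat_exp ('X^2 * (P - P^`())) t).
Proof.
have [t0|t0|->] := ltgtP t 0.
- rewrite {2}/flat_exp ltNge (ltW t0)/=.
  apply: (@near_eq_is_derive _ _ _ (cst 0)) => //.
  near=> x; rewrite /flat_exp ifF//; apply/negbTE; rewrite -leNgt ltW//.
  by near: x; exact: lt_nbhsl.
- rewrite {2}/flat_exp t0.
  apply: (@near_eq_is_derive _ _ _ ((fun x : R => P.[x^-1]) * (fun x : R => expR (- x^-1)))).
    near=> x; rewrite /flat_exp ifT// .
    by near: x; exact: lt_nbhsr.
  have dV : is_derive t 1 (fun x : R => x^-1) (- t ^- 2 *: 1).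
    by apply: is_deriveV; rewrite gt_eqF.
  have h1 : is_derive t 1 (fun x : R => P.[x^-1]) (P^`().[t^-1] * (- t ^- 2 *: 1)).
    exact: (@is_derive1_comp _ (horner P) (fun x : R => x^-1)).
  have h2 : is_derive t 1 (fun x : R => expR (- x^-1)) (expR (- t^-1) * (- (- t ^- 2 *: 1))).
    by apply: (@is_derive1_comp _ expR (fun x : R => - x^-1)).
  move: (is_deriveM h1 h2); congr (is_derive _ _ _ _).
  rewrite !hornerE/= /GRing.scale/= !mulr1 exprVn; ring.
- rewrite {2}/flat_exp ltxx.
  have [C [C0 hC]] := flat_exp_le_sqr P.
  have : h^-1 *: ((flat_exp P \o shift (0:R)) (h *: (1:R)) - flat_exp P 0) @[h --> 0^'] --> (0 : R).
    apply/cvgr0Pnorm_lt => e e0.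
    have : \forall h \near (0:R)^', `|h| < e / (C + 1).
      apply: nbhs_dnbhs; apply/nbhs_ballP; exists (e / (C + 1)) => /=; first by rewrite divr_gt0// ltr_wpDl.
      by move=> y; rewrite /ball/= sub0r normrN.
    move=> hh; near=> h.
    rewrite /= addr0 /GRing.scale/= mulr1 {2}/flat_exp ltxx subr0 normrM normfV.
    have h0 : h != 0 by near: h; exact: nbhs_dnbhs_neq.
    have hp : 0 < `|h| by rewrite normr_gt0.
    rewrite mulrC ltr_pdivrMr//; apply: le_lt_trans (hC h) _.
    rewrite -real_normK ?num_real// expr2 mulrA ltr_pM2r//.
    have : `|h| < e / (C + 1) by near: h.
    rewrite ltr_pdivlMr ?ltr_wpDl// mulrDr mulr1 mulrC; apply: le_lt_trans.
    by rewrite lerDl.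
  move=> cv; apply: DeriveDef; first by apply/cvg_ex; exists 0.
  by apply: cvg_lim cv => //; exact: norm_hausdorff.
Unshelve. all: by end_near. Qed.

Lemma continuous_flat_exp P : continuous (flat_exp P).
Proof.
move=> t; apply: differentiable_continuous; apply/derivable1_diffP.
exact: (@ex_derive _ _ _ _ _ _ _ (is_derive_flat_exp P t)).
Qed.

Lemma flat_exp_ge0 t : 0 <= flat_exp 1 t.
Proof.
by rewrite /flat_exp; case: ifP => // _; rewrite hornerC mul1r expR_ge0.
Qed.

Lemma flat_exp_le1 t : flat_exp 1 t <= 1.
Proof.
rewrite /flat_exp; case: ifPn => // t0.
by rewrite hornerC mul1r -expR0 ler_expR oppr_le0 invr_ge0 ltW.
Qed.

Lemma flat_exp_cvg t : 0 < t -> flat_exp 1 (n%:R * t) @[n --> \oo] --> (1 : R).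
Proof.
move=> t0.
have : expR (- (n%:R * t)^-1) @[n --> \oo] --> expR (- 0 : R).
  apply: (@continuous_cvg _ _ _ _ _ _ expR); first exact: continuous_expR.
  apply: cvgN; apply/cvgr0Pnorm_lt => e e0.
  near=> n.
  have n0 : 0 < n%:R :> R by rewrite ltr0n; near: n; exact: nbhs_infty_gt.
  rewrite ger0_norm ?invr_ge0 ?mulr_ge0 ?ltW// invf_plt ?posrE ?mulr_gt0//.
  rewrite -ltr_pdivrMr//; near: n; exact: nbhs_infty_gtr.
rewrite oppr0 expR0; apply: cvg_trans; apply: near_eq_cvg; near=> n.
have n0 : 0 < n%:R :> R by rewrite ltr0n; near: n; exact: nbhs_infty_gt.
by rewrite /flat_exp mulr_gt0// hornerC mul1r.
Unshelve. all: by end_near. Qed.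

End FlatExponential.

Section SmoothFunctions.
Context {R : realType}.
Implicit Types (f g phi : scalar_field R).

Lemma Ck_continuous k f : Ck k f -> continuous f.
Proof. by case: k => [|k] []. Qed.

Lemma CkS k f : Ck k.+1 f -> Ck k f.
Proof.
elim: k f => [|k IH] f [cf hf]; split => // i.
by have [df Cf] := hf i; split => //; exact: IH.
Qed.

Lemma CkD k f g : Ck k f -> Ck k g -> Ck k (f + g).
Proof.
elim: k f g => [|k IH] f g [cf hf] [cg hg].
  by split => // x; apply: cvgD; [exact: cf|exact: cg].
split; first by move=> x; apply: cvgD; [exact: cf|exact: cg].
move=> i; have [df Cf] := hf i; have [dg Cg] := hg i.
split; first by move=> x; exact: derivableD.
rewrite (_ : 'D__ (f + g) = 'D_(Defs.basis i) f + 'D_(Defs.basis i) g); first exact: IH.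
by apply/funext => x; exact: deriveD.
Qed.

Lemma CkM k f g : Ck k f -> Ck k g -> Ck k (f * g).
Proof.
elim: k f g => [|k IH] f g hf hg.
  split => // x; apply: cvgM; [exact: (Ck_continuous hf)|exact: (Ck_continuous hg)].
split; first by move=> x; apply: cvgM; [exact: (Ck_continuous hf)|exact: (Ck_continuous hg)].
move=> i; have [df Cf] := hf.2 i; have [dg Cg] := hg.2 i.
split; first by move=> x; exact: derivableM.
rewrite (_ : 'D__ (f * g) = f * 'D_(Defs.basis i) g + g * 'D_(Defs.basis i) f).
  by apply: CkD; apply: IH => //; exact: CkS.
by apply/funext => x; rewrite deriveM.
Qed.

Lemma Ck_cst k (c : R) : Ck k (cst c : scalar_field R).
Proof.
elim: k c => [|k IH] c; (split; first by move=> x; exact: cvg_cst) => // i; split.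
  by move=> x; exact: derivable_cst.
rewrite (_ : 'D__ _ = cst 0); first exact: IH.
by apply/funext => x; exact: derive_cst.
Qed.

Lemma CkB k f g : Ck k f -> Ck k g -> Ck k (f - g).
Proof.
move=> hf hg; rewrite (_ : f - g = f + cst (-1) * g).
  by apply: CkD => //; apply: CkM => //; exact: Ck_cst.
by apply/funext => x; rewrite !fctE mulN1r.
Qed.

Lemma derive_line (V : normedModType R) (f : V -> R) (x v : V) :
  'D_v f x = 'D_1 (fun h : R => f (h *: v + x)) 0.
Proof.
rewrite /derive; apply: (f_equal (fun F : R -> R => lim (F @ (0 : R)^'))).
by apply/funext => h; rewrite /shift/= scale0r add0r addr0 [h%:A]mulr1.
Qed.

Let affine (a b c : R) (x : plane R) := a * x.1 + b * x.2 + c.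

Lemma continuous_affine a b c : continuous (affine a b c).
Proof.
move=> x; apply: cvgD; last exact: cvg_cst.
by apply: cvgD; apply: cvgM; [exact: cvg_cst|exact: cvg_fst|exact: cvg_cst|exact: cvg_snd].
Qed.

Lemma is_derive_flat_exp_affine (P : {poly R}) a b c (x v : plane R) :
  is_derive x v (flat_exp P \o affine a b c)
    ((a * v.1 + b * v.2) * flat_exp ('X^2 * (P - P^`())) (affine a b c x)).
Proof.
pose L (h : R) := h * (a * v.1 + b * v.2) + affine a b c x.
have LE : (fun h : R => (flat_exp P \o affine a b c) (h *: v + x)) = flat_exp P \o L.
  by apply/funext => h /=; congr flat_exp; rewrite /L /affine /= /GRing.scale/=; ring.
have dL : is_derive (0 : R) 1 L (a * v.1 + b * v.2).
  move: (is_deriveD (is_deriveM (@is_derive_id R R 0 1) (@is_derive_cst R R R (a * v.1 + b * v.2) 0 1))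
    (@is_derive_cst R R R (affine a b c x) 0 1)).
  by congr (is_derive _ _ _ _); rewrite /GRing.scale/= mulr1 addr0 mul0r add0r.
have L0 : L 0 = affine a b c x by rewrite /L mul0r add0r.
have dc : is_derive (0 : R) 1 (flat_exp P \o L)
    (flat_exp ('X^2 * (P - P^`())) (L 0) * (a * v.1 + b * v.2)).
  by apply: is_derive1_comp; exact: is_derive_flat_exp.
have [dc1 dc2] := dc; rewrite -LE in dc1 dc2.
apply: DeriveDef; first exact/derivable1P.
by rewrite mulrC -L0 -dc2 -derive_line.
Qed.

Lemma Ck_flat_exp_affine k (P : {poly R}) a b c : Ck k (flat_exp P \o affine a b c).
Proof.
have cP Q : continuous (flat_exp Q \o affine a b c).
  move=> x; apply: continuous_comp; [exact: continuous_affine|exact: continuous_flat_exp].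
elim: k P => [|k IH] P; split => // i; split.
  move=> x; exact: (@ex_derive _ _ _ _ _ _ _ (is_derive_flat_exp_affine P a b c x (Defs.basis i))).
rewrite (_ : 'D__ _ = cst (a * (Defs.basis i).1 + b * (Defs.basis i).2) * (flat_exp ('X^2 * (P - P^`())) \o affine a b c)).
  by apply: CkM; [exact: Ck_cst|exact: IH].
apply/funext => x; exact: (@derive_val _ _ _ _ _ _ _ (is_derive_flat_exp_affine P a b c x (Defs.basis i))).
Qed.

(** A product of flat exponentials of the signed distances to the sides of the
    box, rescaled by [n]: it vanishes outside the box and tends to 1 inside. *)
Definition bump (a b c d : R) (n : nat) : scalar_field R :=
  (flat_exp 1 \o affine n%:R 0 (- (n%:R * a))) * (flat_exp 1 \o affine (- n%:R) 0 (n%:R * b)) *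
  ((flat_exp 1 \o affine 0 n%:R (- (n%:R * c))) * (flat_exp 1 \o affine 0 (- n%:R) (n%:R * d))).

Lemma bumpE a b c d n x : bump a b c d n x =
  flat_exp 1 (n%:R * (x.1 - a)) * flat_exp 1 (n%:R * (b - x.1)) *
  (flat_exp 1 (n%:R * (x.2 - c)) * flat_exp 1 (n%:R * (d - x.2))).
Proof.
by rewrite /bump !fctE /affine /=; congr (flat_exp _ _ * flat_exp _ _ * (flat_exp _ _ * flat_exp _ _)); ring.
Qed.

Lemma test_function_bump (A : set (plane R)) a b c d n :
  `[a, b] `*` `[c, d] `<=` A -> test_function A (bump a b c d n).
Proof.
move=> sub; split.
  by move=> k; rewrite /bump; do 2 apply: CkM; try apply: CkM; exact: Ck_flat_exp_affine.
exists (`[a, b] `*` `[c, d]); split => //; first exact: compact_cbox.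
have flat0 t : t <= 0 -> flat_exp 1 (n%:R * t) = 0 :> R.
  by move=> t0; rewrite /flat_exp ltNge mulr_ge0_le0.
move=> x; rewrite bumpE /= !in_itv/=.
have [xa _|xa] := leP x.1 a; first by rewrite flat0 ?subr_le0// !mul0r.
have [xb _|xb] := leP b x.1; first by rewrite (flat0 (b - x.1)) ?subr_le0// mulr0 mul0r.
have [xc _|xc] := leP x.2 c; first by rewrite (flat0 (x.2 - c)) ?subr_le0// mul0r mulr0.
have [xd _|xd] := leP d x.2; first by rewrite (flat0 (d - x.2)) ?subr_le0// !mulr0.
by case; rewrite !ltW.
Qed.

Lemma bump_ge0 a b c d n x : 0 <= bump a b c d n x.
Proof. by rewrite bumpE !mulr_ge0 ?flat_exp_ge0. Qed.

Lemma bump_le1 a b c d n x : bump a b c d n x <= 1.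
Proof.
by rewrite bumpE; do !apply: mulr_ile1; rewrite ?mulr_ge0 ?flat_exp_ge0 ?flat_exp_le1.
Qed.

Lemma bump_cvg a b c d x :
  bump a b c d n x @[n --> \oo] --> (\1_(`]a, b[ `*` `]c, d[) x : R).
Proof.
under eq_fun do rewrite bumpE.
have [[/=]|nx] := pselect ((`]a, b[ `*` `]c, d[) x).
  rewrite !in_itv/= => /andP[ax xb] /andP[cx xd].
  rewrite indicE mem_set/=; last by split; rewrite /= in_itv/= ?ax ?cx.
  have -> : true%:R = 1 * 1 * (1 * 1) :> R by rewrite !mulr1.
  by apply: cvgM; apply: cvgM; apply: flat_exp_cvg; rewrite subr_gt0.
rewrite indicE memNset//= (_ : (fun n => _) = cst 0); first exact: cvg_cst.
apply/funext => n.
have flat0 t : t <= 0 -> flat_exp 1 (n%:R * t) = 0 :> R.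
  by move=> t0; rewrite /flat_exp ltNge mulr_ge0_le0.
have [xa|xa] := leP x.1 a; first by rewrite flat0 ?subr_le0// !mul0r.
have [xb|xb] := leP b x.1; first by rewrite (flat0 (b - x.1)) ?subr_le0// mulr0 mul0r.
have [xc|xc] := leP x.2 c; first by rewrite (flat0 (x.2 - c)) ?subr_le0// mul0r mulr0.
have [xd|xd] := leP d x.2; first by rewrite (flat0 (d - x.2)) ?subr_le0// !mulr0.
by case: nx; split => /=; rewrite in_itv/= ?xa ?xc.
Qed.

End SmoothFunctions.

(** * The fundamental lemma of the calculus of variations *)

Section FundamentalLemma.
Context {R : realType}.
Implicit Types (A : set (plane R)) (g phi : scalar_field R).

Lemma ae_leb2_imp (P Q : plane R -> Prop) : (forall x, P x -> Q x) ->
  (\forall x \ae leb2, P x) -> \forall x \ae leb2, Q x.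
Proof. by move=> PQ; apply: negligibleS => x nQ Px; apply: nQ; exact: PQ. Qed.

Lemma ae_leb2_and (P Q : plane R -> Prop) :
  (\forall x \ae leb2, P x) -> (\forall x \ae leb2, Q x) -> \forall x \ae leb2, P x /\ Q x.
Proof.
by move=> hP hQ; apply: negligibleS (negligibleU hP hQ) => x /= /not_andP.
Qed.

Lemma ae_forall_ord2 (P : 'I_2 -> plane R -> Prop) :
  (forall i, \forall x \ae leb2, P i x) -> \forall x \ae leb2, forall i, P i x.
Proof.
move=> h; apply: ae_leb2_imp (ae_leb2_and (h ord0) (h ord_max)) => x [h0 h1].
move=> -[[|[|//]] ilt].
  by rewrite (_ : Ordinal ilt = ord0); [exact: h0|exact: val_inj].
by rewrite (_ : Ordinal ilt = ord_max); [exact: h1|exact: val_inj].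
Qed.

Lemma test_function_measurable A phi : test_function A phi ->
  measurable_fun setT (phi : mplane R -> R).
Proof. by move=> [/(_ 0%N)[cphi _] _]; exact: continuous_measurable_plane. Qed.

Lemma Rintegral_eq0 (D : set (mplane R)) (g : mplane R -> R) : measurable D ->
  leb2.-integrable D (EFin \o g) -> \int[leb2]_(x in D) g x = 0 ->
  (\int[leb2]_(x in D) (g x)%:E = 0)%E.
Proof.
by move=> mD ig; have /fineK <- := integrable_fin_num mD ig; rewrite /Rintegral => ->.
Qed.

Lemma Rintegral_supported (D K : set (mplane R)) (g : mplane R -> R) :
  K `<=` D -> (forall x, ~ K x -> g x = 0) ->
  \int[leb2]_(x in D) g x = \int[leb2]_(x in K) g x.
Proof.
move=> KD g0; rewrite Rintegral_mkcond [RHS]Rintegral_mkcond; congr (Rintegral _ _ _).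
apply/funext => x; rewrite !patchE; case: ifPn => [xD|xD]; case: ifPn => [xK|xK] //.
  by rewrite g0// => Kx; rewrite mem_set in xK.
by move: xD; rewrite mem_set//; apply: KD; rewrite inE in xK.
Qed.

(** The bumps of the small box are test functions on [A], bounded by 1, and
    converge to its indicator: dominated convergence applies. *)
Lemma box_integral_eq0 A g (a b c d a' b' c' d' : R) :
  L1loc A g -> (forall phi, test_function A phi ->
    \int[leb2]_(x in A) (g x * phi x) = 0) ->
  `[a, b] `*` `[c, d] `<=` A -> a <= a' -> b' <= b -> c <= c' -> d' <= d ->
  (\int[leb2]_(x in `]a', b'[ `*` `]c', d'[) (g x)%:E = 0)%E.
Proof.
move=> [mg ig] hg sub aa bb cc dd.
set Q : set (mplane R) := `[a, b] `*` `[c, d] in sub *.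
set B : set (mplane R) := `]a', b'[ `*` `]c', d'[.
have mQ : measurable Q by exact: measurable_cbox.
have mB : measurable B by exact: measurable_box.
have iQ : leb2.-integrable Q (EFin \o g) by apply: ig => //; exact: compact_cbox.
have mgQ : measurable_fun Q (g : mplane R -> R).
  by have /measurable_int/measurable_EFinP := iQ.
have subQ' : (`[a', b'] `*` `[c', d'] : set (plane R)) `<=` Q.
  move=> [x y] [] /=; rewrite !in_itv/= => /andP[x1 x2] /andP[y1 y2].
  by split; rewrite /= in_itv/= ?(le_trans aa)// ?(le_trans cc)// ?(le_trans x2)// ?(le_trans y2).
have tb n : test_function A (bump a' b' c' d' n).
  by apply: test_function_bump => x /subQ'/sub.
have bE n x : ~ Q x -> bump a' b' c' d' n x = 0.
  move=> nQ; have [_ [K [_ KQ h]]] := @test_function_bump R Q a' b' c' d' n subQ'.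
  by apply: h => /KQ.
have mb n : measurable_fun Q (bump a' b' c' d' n : mplane R -> R).
  exact: measurable_funTS (test_function_measurable (tb n)).
have h n : (\int[leb2]_(x in Q) (g x * bump a' b' c' d' n x)%:E = 0)%E.
  apply: Rintegral_eq0 => //.
    apply: (le_integrable _ _ _ iQ) => //.
      by apply/measurable_EFinP; exact: measurable_funM.
    move=> x _ /=; rewrite lee_fin normrM (ger0_norm (bump_ge0 _ _ _ _ _ _)).
    by rewrite ler_piMr ?bump_le1.
  rewrite -(@Rintegral_supported A) ?hg// => x nQ.
  by rewrite bE ?mulr0.
have [|||||_ _] := @dominated_convergence _ _ _ leb2 Q mQ
  (fun n x => (g x * bump a' b' c' d' n x)%:E) (fun x => (g x * \1_B x)%:E)
  (fun x => `|(g x)%:E|%E).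
- by move=> n; apply/measurable_EFinP; exact: measurable_funM.
- by apply/measurable_EFinP; apply: measurable_funM => //; exact: measurable_indic.
- apply: aeW => x _; apply: cvg_EFin; first exact: nearW.
  by apply: cvgM; [exact: cvg_cst|exact: bump_cvg].
- exact: integrable_abse iQ.
- apply: aeW => x n _; rewrite abse_EFin lee_fin normrM (ger0_norm (bump_ge0 _ _ _ _ _ _)).
  by rewrite ler_piMr ?bump_le1.
have -> : (\int[leb2]_(x in B) (g x)%:E = \int[leb2]_(x in Q) (g x * \1_B x)%:E)%E.
  have QB : Q `&` B = B.
    apply/seteqP; split => [x []//|x Bx]; split => //; apply: subQ'; case: Bx => [/= ? ?].
    by split; exact: subset_itv_oo_cc.
  rewrite -{1}QB integral_mkcondr; apply: eq_integral => x _.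
  by rewrite patchE indicE; case: ifPn => xB; rewrite ?mulr1 ?mulr0.
rewrite (_ : [sequence _]_n = cst 0%E); last by apply/funext => n; exact: h.
by move/cvg_lim => <-//; rewrite lim_cst.
Qed.

(** The sets on which the integral of [g] vanishes form a Dynkin system, and
    boxes are a pi-system that generates the measurable sets. *)
Lemma integral_eq0_box A g (a b c d : R) :
  L1loc A g -> (forall phi, test_function A phi ->
    \int[leb2]_(x in A) (g x * phi x) = 0) ->
  `[a, b] `*` `[c, d] `<=` A ->
  \forall x \ae leb2, (`]a, b[ `*` `]c, d[) x -> g x = 0.
Proof.
move=> lg hg sub; set Q : set (mplane R) := `]a, b[ `*` `]c, d[.
have mQ : measurable Q by exact: measurable_box.
have subQ : Q `<=` `[a, b] `*` `[c, d].
  by move=> [x y] [/= ? ?]; split; exact: subset_itv_oo_cc.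
have iQ : leb2.-integrable Q (EFin \o g).
  apply: (@integrableS _ _ _ leb2 (`[a, b] `*` `[c, d])) => //.
    exact: measurable_cbox.
  by apply: lg.2 => //; exact: compact_cbox.
have PE : forall E : set (mplane R), measurable E -> (\int[leb2]_(x in Q `&` E) (g x)%:E = 0)%E.
  move=> E0; rewrite measurable_boxes; move: E0.
  apply: (@dynkin_induction _ (mplane R) (@boxes R) [set E | (\int[leb2]_(x in Q `&` E) (g x)%:E = 0)%E]).
  - exact: measurable_boxes.
  - exact: setI_closed_boxes.
  - by rewrite /= setIT (@box_integral_eq0 A g a b c d).
  - move=> _ [a' [b' [c' [d' ->]]]] /=.
    rewrite /Q boxI.
    by apply: (@box_integral_eq0 A g a b c d) => //; rewrite ?le_max ?ge_min lexx.
  - move=> E mE /= QE0; move: (@box_integral_eq0 A g a b c d a b c d lg hg sub (lexx _) (lexx _) (lexx _) (lexx _)).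
    rewrite -/Q -{1}(setIT Q) -(setUv E) setIUr integral_setU//=.
    + by rewrite QE0 add0e.
    + exact: measurableI.
    + by apply: measurableI => //; exact: measurableC.
    + rewrite -setIUr setUv setIT; exact: measurable_int iQ.
    + by apply/disj_setPS => x [[_ ?] [_ /=]].
  - move=> F mF tF hF /=; rewrite setI_bigcupr integral_bigcup.
    + by rewrite eseries0// => i _ _; exact: hF.
    + by apply: trivIset_setIl.
    + by move=> k; exact: measurableI.
    + rewrite -setI_bigcupr; apply: integrableS iQ => //.
      by apply: measurableI => //; exact: bigcup_measurable.
have : ae_eq leb2 Q (EFin \o g) (cst 0%E).
  apply: integral_ae_eq => //.
  by move=> E EQ mE; rewrite integral0 -(PE E mE); congr integral; rewrite setIidr.
by apply: filterS => x h /h /= [].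
Qed.

Lemma fundamental_lemma A g : open A -> L1loc A g ->
  (forall phi, test_function A phi -> \int[leb2]_(x in A) (g x * phi x) = 0) ->
  \forall x \ae leb2, A x -> g x = 0.
Proof.
move=> oA lg hg; have [a [b [c [d [sub AE]]]]] := open_bigcup_box oA.
have : \forall x \ae leb2, forall n, (`]a n, b n[ `*` `]c n, d n[) x -> g x = 0.
  by apply/ae_foralln => n; exact: (integral_eq0_box lg hg (sub n)).
by apply: ae_leb2_imp => x h; rewrite AE => -[n _]; exact: h.
Qed.

End FundamentalLemma.

(** * Test functions *)

Section TestFunctions.
Context {R : realType}.
Implicit Types (A K : set (plane R)) (f u phi : scalar_field R).

Lemma continuous_bounded_on K f : compact K -> continuous f ->
  exists M : R, 0 <= M /\ forall x, K x -> `|f x| <= M.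
Proof.
move=> cK cf; have [M [_ hM]] : bounded_set (f @` K).
  by apply: compact_bounded; apply: continuous_compact => //; exact: continuous_subspaceT.
exists (`|M| + 1); split; first by rewrite addr_ge0.
move=> x Kx; apply: (hM (`|M| + 1)); last by exists x.
by rewrite (le_lt_trans (ler_norm _))// ltrDl.
Qed.

Lemma derive_supported K phi (i : 'I_2) : compact K -> (forall x, ~ K x -> phi x = 0) ->
  forall x, ~ K x -> 'D_(Defs.basis i) phi x = 0.
Proof.
move=> cK phi0 x nK.
rewrite (@near_eq_derive _ _ _ phi (cst 0)) ?derive_cst//.
have : open (~` K) by rewrite openC; apply: compact_closed => //; exact: norm_hausdorff.
move=> oK; have : nbhs x (~` K) by exact: open_nbhs_nbhs.
by apply: filterS => y /= /phi0.
Qed.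

Lemma test_functionD A phi (i : 'I_2) : test_function A phi ->
  test_function A ('D_(Defs.basis i) phi).
Proof.
move=> [sm [K [cK KA phi0]]]; split; first by move=> k; have [_ /(_ i)[]] := sm k.+1.
by exists K; split => //; exact: derive_supported.
Qed.

Lemma test_functionM A phi f : test_function A phi -> test_function A f ->
  test_function A (phi * f).
Proof.
move=> [sm [K [cK KA phi0]]] [sf _]; split; first by move=> k; exact: CkM.
by exists K; split => // x /phi0 h; rewrite !fctE h mul0r.
Qed.

Lemma test_functionB A phi f : test_function A phi -> test_function A f ->
  test_function A (phi - f).
Proof.
move=> [sm [K [cK KA phi0]]] [sf [L [cL LA f0]]]; split; first by move=> k; exact: CkB.
exists (K `|` L); split => //; first exact: compactU.
  by move=> x [/KA|/LA].
by move=> x /not_orP[/phi0 h1 /f0 h2]; rewrite !fctE h1 h2 subrr.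
Qed.

Lemma test_function_bounded A phi : test_function A phi ->
  exists M : R, 0 <= M /\ forall x, `|phi x| <= M.
Proof.
move=> [sm [K [cK KA phi0]]].
have [M [M0 hM]] := continuous_bounded_on cK (Ck_continuous (sm 0%N)).
exists M; split => // x; have [/hM//|/phi0 ->] := pselect (K x).
by rewrite normr0.
Qed.

Lemma integrable_supported (D K : set (mplane R)) (f : mplane R -> R) :
  measurable D -> K `<=` D -> measurable K -> (forall x, ~ K x -> f x = 0) ->
  leb2.-integrable K (EFin \o f) -> leb2.-integrable D (EFin \o f).
Proof.
move=> mD KD mK f0 /(integrable_mkcond _ mK) iK; apply/(integrable_mkcond _ mD).
rewrite (_ : _ \_ D = (EFin \o f) \_ K)//; apply/funext => x; rewrite !patchE.
case: ifPn => [xD|xD]; case: ifPn => [xK|xK] //=.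
  by rewrite f0// => Kx; rewrite mem_set in xK.
by move: xD; rewrite mem_set//; apply: KD; rewrite inE in xK.
Qed.

Lemma L1loc_test_integrable A u phi : measurable (A : set (mplane R)) ->
  L1loc A u -> test_function A phi ->
  leb2.-integrable A (EFin \o (fun x => u x * phi x)).
Proof.
move=> mA [mu iu] tphi; have [M [M0 hM]] := test_function_bounded tphi.
have [_ [K [cK KA phi0]]] := tphi.
have mK := compact_measurable_plane cK.
apply: (integrable_supported mA KA mK) => [x /phi0 ->|]; first by rewrite mulr0.
have iK := iu K cK KA.
apply: (le_integrable mK _ _ (integrableZl mK M iK)) => //.
  apply/measurable_EFinP; apply: measurable_funM.
    by have /measurable_int/measurable_EFinP := iK.
  exact: measurable_funTS (test_function_measurable tphi).
move=> x _ /=; rewrite lee_fin !normrM mulrC ler_wpM2r//.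
by rewrite (ger0_norm M0).
Qed.

Lemma L1loc_test A phi : test_function A phi -> L1loc A phi.
Proof.
move=> tphi; have mphi := test_function_measurable tphi.
split; first exact: (@measurable_funTS _ _ (mplane R) _ _ _ mphi).
move=> K cK KA; have [M [M0 hM]] := test_function_bounded tphi.
apply: measurable_bounded_integrable.
- exact: compact_measurable_plane.
- apply: bounded_leb2_lty; [exact: compact_measurable_plane|exact: compact_bounded].
- exact: measurable_funTS.
- exists M; split; first exact: num_real.
  by move=> y My x _ /=; exact: le_trans (hM x) (ltW My).
Qed.

Lemma integral_derive_eq0 (F f : R -> R) (M : R) : 0 < M ->
  (forall t : R, is_derive t 1 F (f t)) -> continuous f ->
  (forall t, ~~ (`|t| < M) -> F t = 0 /\ f t = 0) ->
  (\int[lebesgue_measure]_t (f t)%:E = 0)%E.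
Proof.
move=> M0 dF cf F0.
have dF1 t : derivable F t 1 by exact: (@ex_derive _ _ _ _ _ _ _ (dF t)).
have cF : continuous F.
  by move=> t; apply: differentiable_continuous; apply/derivable1_diffP.
have -> : (fun t => (f t)%:E) = (fun t => (f t)%:E) \_ `[- M, M].
  apply/funext => t; rewrite patchE; case: ifPn => // tM; rewrite (F0 t _).2//.
  apply: contra tM; rewrite ltr_norml => /andP[h1 h2].
  by rewrite mem_set//= in_itv/= !ltW.
rewrite -integral_mkcond (@continuous_FTC2 _ _ F).
- by rewrite (F0 M _).1 ?(F0 (- M) _).1 ?subee// ?normrN (ger0_norm (ltW M0)) ltxx.
- by rewrite gtrN.
- exact: continuous_subspaceT.
- split; first by move=> t _; exact: dF1.
    by apply: cvg_at_right_filter; exact: cF.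
  by apply: cvg_at_left_filter; exact: cF.
- by move=> t _; rewrite derive1E; exact: (@derive_val _ _ _ _ _ _ _ (dF t)).
Qed.

Lemma slice1 f x y : (fun h : R => f (h *: Defs.basis ord0 + (x, y))) =
  (fun h : R => (fun t => f (t, y)) (h *: (1 : R) + x)).
Proof.
apply/funext => h; congr f; rewrite /Defs.basis/=.
by apply: injective_projections => //=; rewrite scaler0 add0r.
Qed.

Lemma slice2 f x y : (fun h : R => f (h *: Defs.basis ord_max + (x, y))) =
  (fun h : R => (fun t => f (x, t)) (h *: (1 : R) + y)).
Proof.
apply/funext => h; congr f; rewrite /Defs.basis/=.
by apply: injective_projections => //=; rewrite scaler0 add0r.
Qed.

(** Fubini's theorem reduces this to the fundamental theorem of calculus along
    the lines parallel to a coordinate axis. *)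
Lemma integral_derive_test_eq0 A chi (i : 'I_2) : test_function A chi ->
  (\int[leb2]_x ('D_(Defs.basis i) chi x)%:E = 0)%E.
Proof.
move=> tchi; have tD := test_functionD i tchi.
have [sm [K [cK KA chi0]]] := tchi.
have D0 := derive_supported i cK chi0.
have [M0 KM0] := bounded_sub_cbox (compact_bounded cK).
have [M [M1 KM]] : exists M : R, 0 < M /\ forall x, K x -> `|x.1| < M /\ `|x.2| < M.
  exists (`|M0| + 1); split; first by rewrite ltr_wpDl.
  move=> x /KM0[/=]; rewrite !in_itv/= -!ler_norml => h1 h2.
  by split; (apply: le_lt_trans; first exact: h1 || exact: h2); rewrite ltr_pwDr// ler_norm.
have iD : leb2.-integrable setT (EFin \o 'D_(Defs.basis i) chi).
  apply: (@integrable_supported setT K) => //; first exact: compact_measurable_plane.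
  exact: (L1loc_test tD).2.
have dchi j x : derivable chi x (Defs.basis j) by have [_ /(_ j)[]] := sm 1%N.
have cD : continuous ('D_(Defs.basis i) chi) by have [/(_ 0%N)[]] := tD.
have [i0|i1] : i = ord0 \/ i = ord_max.
  by case: (i) => -[|[|//]] h; [left|right]; exact: val_inj.
- have h0 (y : R) : (\int[lebesgue_measure]_t ('D_(Defs.basis i) chi (t, y))%:E = 0)%E.
    apply: (@integral_derive_eq0 (fun t => chi (t, y)) _ M M1).
    + move=> t; apply: DeriveDef; last by rewrite i0 [LHS]derive_line [RHS]derive_line slice1.
      by apply/derivable1P; have /derivable1P := dchi i (t, y); rewrite i0 slice1.
    + move=> t; apply: (@continuous_comp _ _ _ (fun t : R => (t, y)) ('D_(Defs.basis i) chi)); last exact: cD.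
      exact: (@cvg_pair R R R (nbhs t) (nbhs t) (nbhs y) _ _ _ id (fun=> y) cvg_id (cvg_cst y)).
    + by move=> t tM; split; [apply: chi0|apply: D0] => /KM[/= h _]; rewrite h in tM.
  rewrite -[LHS](integral21_prod_meas1 iD) -[RHS](@integral0 _ _ _ lebesgue_measure setT).
  by apply: eq_integral => y _; exact: h0.
- have h0 (y : R) : (\int[lebesgue_measure]_t ('D_(Defs.basis i) chi (y, t))%:E = 0)%E.
    apply: (@integral_derive_eq0 (fun t => chi (y, t)) _ M M1).
    + move=> t; apply: DeriveDef; last by rewrite i1 [LHS]derive_line [RHS]derive_line slice2.
      by apply/derivable1P; have /derivable1P := dchi i (y, t); rewrite i1 slice2.
    + move=> t; apply: (@continuous_comp _ _ _ (fun t : R => (y, t)) ('D_(Defs.basis i) chi)); last exact: cD.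
      exact: (@cvg_pair R R R (nbhs t) (nbhs y) (nbhs t) _ _ _ (fun=> y) id (cvg_cst y) cvg_id).
    + by move=> t tM; split; [apply: chi0|apply: D0] => /KM[/= _ h]; rewrite h in tM.
  rewrite -[LHS](integral12_prod_meas1 iD) -[RHS](@integral0 _ _ _ lebesgue_measure setT).
  by apply: eq_integral => y _; exact: h0.
Qed.

End TestFunctions.

(** * Weak derivatives *)

Section WeakDerivatives.
Context {R : realType}.
Implicit Types (A K : set (plane R)) (f g u v phi : scalar_field R) (i : 'I_2).

Definition weakly_derivable A i u := exists g, is_weak_deriv A i u g.

Lemma L1loc_ext A u v : {in A, u =1 v} -> L1loc A u -> L1loc A v.
Proof.
move=> uv [mu iu]; split; first exact: eq_measurable_fun mu.
move=> K cK KA; apply: eq_integrable (iu K cK KA); first exact: compact_measurable_plane.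
by move=> x; rewrite inE => /KA Ax; congr EFin; apply: uv; rewrite inE.
Qed.

Lemma is_weak_deriv_ext A i u v g : {in A, u =1 v} ->
  is_weak_deriv A i u g -> is_weak_deriv A i v g.
Proof.
move=> uv [lu lg hg]; split => //; first exact: L1loc_ext lu.
by move=> phi tphi; rewrite -hg//; apply: eq_Rintegral => x xA; rewrite uv.
Qed.

Lemma wderiv_ext A i u v : {in A, u =1 v} -> wderiv A i u = wderiv A i v.
Proof.
move=> uv; congr xget; apply/seteqP; split => g; apply: is_weak_deriv_ext => //.
by move=> x xA; rewrite uv.
Qed.

Lemma wderivP A i u : weakly_derivable A i u -> is_weak_deriv A i u (wderiv A i u).
Proof. exact: xgetPex. Qed.

Lemma L1locB A u v : L1loc A u -> L1loc A v -> L1loc A (fun x => u x - v x).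
Proof.
move=> [mu iu] [mv iv]; split; first exact: measurable_funB.
move=> K cK KA; have mK := compact_measurable_plane cK.
by have := integrableB mK (iu K cK KA) (iv K cK KA).
Qed.

Section OpenSet.
Context {A : set (plane R)}.
Hypothesis oA : open A.
Let mA : measurable (A : set (mplane R)) := open_measurable_plane oA.

Lemma Rintegral_testB u v phi : L1loc A u -> L1loc A v -> test_function A phi ->
  \int[leb2]_(x in A) ((u x - v x) * phi x) =
  \int[leb2]_(x in A) (u x * phi x) - \int[leb2]_(x in A) (v x * phi x).
Proof.
move=> lu lv tphi; rewrite -RintegralB//; [|exact: L1loc_test_integrable..].
by apply: eq_Rintegral => x _; rewrite mulrBl.
Qed.

Lemma is_weak_derivB i u v g h : is_weak_deriv A i u g -> is_weak_deriv A i v h ->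
  is_weak_deriv A i (fun x => u x - v x) (fun x => g x - h x).
Proof.
move=> [lu lg hg] [lv lh hh]; split; [exact: L1locB|exact: L1locB|].
move=> phi tphi; rewrite !Rintegral_testB//; last exact: test_functionD.
by rewrite hg// hh// opprB opprK addrC.
Qed.

(** The difference of two weak derivatives is orthogonal to all test
    functions. *)
Lemma is_weak_deriv_unique i u g h : is_weak_deriv A i u g -> is_weak_deriv A i u h ->
  \forall x \ae leb2, A x -> g x = h x.
Proof.
move=> [lu lg hg] [_ lh hh].
apply: ae_leb2_imp (fundamental_lemma oA (L1locB lg lh) _) => [x gh /gh /eqP|].
  by rewrite subr_eq0 => /eqP.
move=> phi tphi; rewrite Rintegral_testB//.
by rewrite -[X in X - _]opprK -hg// -[X in - _ - X]opprK -hh// subrr.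
Qed.

Lemma weakly_derivableB i u v : weakly_derivable A i u -> weakly_derivable A i v ->
  weakly_derivable A i (fun x => u x - v x).
Proof.
by move=> [g hg] [h hh]; exists (fun x => g x - h x); exact: is_weak_derivB.
Qed.

(** [wderiv] chooses a representative for each function separately, so it is
    additive only almost everywhere, by uniqueness. *)
Lemma wderivB i u v : weakly_derivable A i u -> weakly_derivable A i v ->
  \forall x \ae leb2, A x -> wderiv A i (fun x => u x - v x) x = wderiv A i u x - wderiv A i v x.
Proof.
move=> du dv; apply: is_weak_deriv_unique (wderivP (weakly_derivableB du dv)) _.
by apply: is_weak_derivB; exact: wderivP.
Qed.

(** Integration by parts: the derivative of the product of two test functions
    has integral 0. *)
Lemma is_weak_deriv_test i phi : test_function A phi ->
  is_weak_deriv A i phi ('D_(Defs.basis i) phi).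
Proof.
move=> tphi; have tD := test_functionD i tphi.
split; [exact: L1loc_test|exact: L1loc_test|].
move=> psi tpsi; have tDpsi := test_functionD i tpsi.
have E x : 'D_(Defs.basis i) (phi * psi) x = phi x * 'D_(Defs.basis i) psi x + 'D_(Defs.basis i) phi x * psi x.
  have [_ /(_ i)[dphi _]] := tphi.1 1%N; have [_ /(_ i)[dpsi _]] := tpsi.1 1%N.
  by rewrite deriveM// [_ *: 'D_(Defs.basis i) phi x]mulrC.
apply/eqP; rewrite -addr_eq0 -RintegralD//; first last.
- by apply: L1loc_test_integrable => //; exact: L1loc_test.
- by apply: L1loc_test_integrable => //; exact: L1loc_test.
have tpp := test_functionM tphi tpsi.
rewrite (_ : Rintegral _ _ _ = \int[leb2]_(x in A) 'D_(Defs.basis i) (phi * psi) x); last first.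
  by apply: eq_Rintegral => x _; rewrite E.
have [sm [K [cK KA pp0]]] := tpp.
have D0 := derive_supported i cK pp0.
rewrite (Rintegral_supported KA D0) -(Rintegral_supported (@subsetT _ K) D0).
by rewrite /Rintegral (integral_derive_test_eq0 i tpp).
Qed.

End OpenSet.
End WeakDerivatives.

(** * Lebesgue spaces *)

Section LpSpaces.
Context {R : realType}.
Implicit Types (A : set (plane R)) (f g u v : scalar_field R) (p q : R).

Definition integrable_on A f := leb2.-integrable A (EFin \o f).

Section MeasurableSet.
Context {A : set (plane R)}.
Hypothesis mA : measurable (A : set (mplane R)).

Lemma integrable_on_measurable f : integrable_on A f -> measurable_fun A f.
Proof. by move=> /measurable_int/measurable_EFinP. Qed.

Lemma integrable_onD f g : integrable_on A f -> integrable_on A g ->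
  integrable_on A (fun x => f x + g x).
Proof. by move=> hf hg; have := integrableD mA hf hg. Qed.

Lemma integrable_onB f g : integrable_on A f -> integrable_on A g ->
  integrable_on A (fun x => f x - g x).
Proof. by move=> hf hg; have := integrableB mA hf hg. Qed.

Lemma integrable_onZ c f : integrable_on A f -> integrable_on A (fun x => c * f x).
Proof. by move=> hf; have := integrableZl mA c hf. Qed.

Lemma integrable_on_sum (n : nat) (F : 'I_n -> scalar_field R) :
  (forall i, integrable_on A (F i)) -> integrable_on A (fun x => \sum_i F i x).
Proof.
move=> hF; have := @integrable_sum _ _ _ leb2 A mA _ (index_enum 'I_n) xpredT _ (fun i _ => hF i).
by apply: eq_integrable => // x _ /=; rewrite sumEFin.
Qed.

Lemma integrable_on_le f g : measurable_fun A f -> integrable_on A g ->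
  (forall x, A x -> `|f x| <= g x) -> integrable_on A f.
Proof.
move=> mf ig fg; apply: (le_integrable mA _ _ ig); first exact/measurable_EFinP.
by move=> x Ax /=; rewrite lee_fin (le_trans (fg x Ax))// ler_norm.
Qed.

Lemma integrable_on_norm f : integrable_on A f -> integrable_on A (fun x => `|f x|).
Proof. exact: integrable_norm. Qed.

Lemma Rintegral_sum (n : nat) (F : 'I_n -> scalar_field R) :
  (forall i, integrable_on A (F i)) ->
  \int[leb2]_(x in A) (\sum_i F i x) = \sum_i \int[leb2]_(x in A) F i x.
Proof.
elim: n F => [|n IH] F hF.
  rewrite big_ord0 (_ : Rintegral _ _ _ = \int[leb2]_(x in A) 0).
    by rewrite Rintegral_cst// mul0r.
  by apply: eq_Rintegral => x _; rewrite big_ord0.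
rewrite big_ord_recl -IH//= -RintegralD//.
- by apply: eq_Rintegral => x _; rewrite big_ord_recl.
- by apply: hF.
- by apply: integrable_on_sum.
Qed.

Lemma eq_ae_Rintegral f g : measurable_fun A f -> measurable_fun A g ->
  (\forall x \ae leb2, A x -> f x = g x) ->
  \int[leb2]_(x in A) f x = \int[leb2]_(x in A) g x.
Proof.
move=> mf mg fg; rewrite /Rintegral; congr fine; apply: ae_eq_integral => //.
- exact/measurable_EFinP.
- exact/measurable_EFinP.
- by apply: ae_leb2_imp fg => x h /h /= ->.
Qed.

Lemma ae_integrable_on f g : measurable_fun A g ->
  (\forall x \ae leb2, A x -> f x = g x) -> integrable_on A f -> integrable_on A g.
Proof.
move=> mg fg /integrableP[mf If]; apply/integrableP; split; first exact/measurable_EFinP.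
rewrite (_ : integral _ _ _ = \int[leb2]_(x in A) `|(EFin \o f) x|)%E//.
apply: ae_eq_integral => //.
- by apply: measurableT_comp => //; exact/measurable_EFinP.
- by apply: measurableT_comp.
- by apply: ae_leb2_imp fg => x h /h /= ->.
Qed.

Lemma ae_eq0_of_Rintegral f : integrable_on A f -> (forall x, A x -> 0 <= f x) ->
  \int[leb2]_(x in A) f x = 0 -> \forall x \ae leb2, A x -> f x = 0.
Proof.
move=> hf f0 /(Rintegral_eq0 mA hf) I0.
have : ae_eq leb2 A (EFin \o f) (cst 0%E).
  apply/ae_eq_integral_abs => //; first by have /measurable_int := hf.
  rewrite -[RHS]I0; apply: eq_integral => x; rewrite inE => Ax /=.
  by rewrite ger0_norm// f0.
by apply: ae_leb2_imp => x h /h /= [].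
Qed.

Lemma eLp_norm_powE p u : 0 < p ->
  (eLp_norm A p u `^ p = \int[leb2]_(x in A) (`|u x| `^ p)%:E)%E.
Proof.
move=> p0; rewrite /eLp_norm poweR_Lnorm; last by rewrite gt_eqF.
rewrite [RHS]integral_mkcond.
apply: eq_integral => x _ /=; rewrite !patchE; case: ifPn => // _.
by rewrite /= normr0 powR0// gt_eqF.
Qed.

Lemma eLp_norm_ge0 p u : (0 <= eLp_norm A p u)%E.
Proof. exact: Lnorm_ge0. Qed.

Lemma Lp_norm_ge0 p u : 0 <= Lp_norm A p u.
Proof. by rewrite fine_ge0// eLp_norm_ge0. Qed.

Lemma Lp_norm_fineK p u : (eLp_norm A p u < +oo)%E -> (Lp_norm A p u)%:E = eLp_norm A p u.
Proof. by move=> u_fin; rewrite fineK// ge0_fin_numE// eLp_norm_ge0. Qed.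

Lemma measurable_powR_norm p u : measurable_fun A u ->
  measurable_fun A (fun x => `|u x| `^ p).
Proof.
move=> mu; apply: (@measurableT_comp _ _ _ _ _ _ (fun t : R => t `^ p)) => //.
exact: measurableT_comp.
Qed.

Lemma Lp_integrable p u : 0 < p -> Lp A p u ->
  integrable_on A (fun x => `|u x| `^ p).
Proof.
move=> p0 [mu nu]; apply/integrableP; split.
  by apply/measurable_EFinP; exact: measurable_powR_norm.
rewrite (_ : integral _ _ _ = eLp_norm A p u `^ p)%E; first exact: poweR_lty.
rewrite eLp_norm_powE//; apply: eq_integral => x _ /=.
by rewrite ger0_norm// powR_ge0.
Qed.

Lemma integrable_Lp p u : 0 < p -> measurable_fun A u ->
  integrable_on A (fun x => `|u x| `^ p) -> Lp A p u.
Proof.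
move=> p0 mu /integrableP[_ I]; split => //.
rewrite ltey; apply/eqP => E.
move: I; rewrite (_ : integral _ _ _ = eLp_norm A p u `^ p)%E.
  by rewrite E poweRyr ?ltxx// gt_eqF.
rewrite eLp_norm_powE//; apply: eq_integral => x _ /=.
by rewrite ger0_norm// powR_ge0.
Qed.

(** [Lp_norm] is the real part of an extended norm and is 0 when that norm is
    infinite, hence the hypothesis [Lp A p u]. *)
Lemma Lp_norm_powE p u : 0 < p -> Lp A p u ->
  Lp_norm A p u `^ p = \int[leb2]_(x in A) (`|u x| `^ p).
Proof.
move=> p0 [mu nu]; rewrite /Rintegral -eLp_norm_powE//.
have : (eLp_norm A p u \is a fin_num)%E by rewrite ge0_fin_numE// eLp_norm_ge0.
by rewrite /Lp_norm; case: (eLp_norm A p u).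
Qed.

Lemma Lp2_integrable u : Lp A 2 u -> integrable_on A (fun x => u x ^+ 2).
Proof.
move=> /Lp_integrable -/(_ ltac:(by [])).
by apply: eq_integrable => // x _ /=; rewrite powR_mulrn// real_normK// num_real.
Qed.

Lemma integrable_Lp2 u : measurable_fun A u ->
  integrable_on A (fun x => u x ^+ 2) -> Lp A 2 u.
Proof.
move=> mu iu; apply: integrable_Lp => //.
by apply: eq_integrable iu => // x _ /=; rewrite powR_mulrn// real_normK// num_real.
Qed.

Lemma Lp2_norm_sqr u : Lp A 2 u -> Lp_norm A 2 u ^+ 2 = \int[leb2]_(x in A) (u x ^+ 2).
Proof.
move=> Lu; rewrite -powR_mulrn ?Lp_norm_ge0// Lp_norm_powE//.
by apply: eq_Rintegral => x _; rewrite powR_mulrn// real_normK// num_real.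
Qed.

Lemma Lp_hoelder p q f g : 0 < p -> 0 < q -> p^-1 + q^-1 = 1 ->
  Lp A p f -> Lp A q g ->
  integrable_on A (fun x => f x * g x) /\
  \int[leb2]_(x in A) `|f x * g x| <= Lp_norm A p f * Lp_norm A q g.
Proof.
move=> p0 q0 pq [mf nf] [mg ng].
have fE := Lp_norm_fineK nf; have gE := Lp_norm_fineK ng.
have mfA : measurable_fun setT (f \_ A : mplane R -> R) by apply/(measurable_restrictT _ mA).
have mgA : measurable_fun setT (g \_ A : mplane R -> R) by apply/(measurable_restrictT _ mA).
have := hoelder leb2 mfA mgA p0 q0 pq; rewrite Lnorm1 -/(eLp_norm A p f) -/(eLp_norm A q g).
rewrite -fE -gE -EFinM => H0.
have {}H0 : (\int[leb2]_(x in A) `|f x * g x|%:E <= (Lp_norm A p f * Lp_norm A q g)%:E)%E.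
  apply: le_trans H0; rewrite [leLHS]integral_mkcond le_eqVlt; apply/orP; left; apply/eqP.
  apply: eq_integral => x _ /=; rewrite !patchE.
  by case: ifPn => // _; rewrite mulr0 normr0.
have ifg : integrable_on A (fun x => f x * g x).
  apply/integrableP; split; first by apply/measurable_EFinP; exact: measurable_funM.
  by apply: le_lt_trans H0 _; rewrite ltry.
split => //; rewrite -lee_fin; apply: le_trans H0.
by rewrite fineK//; apply: integrable_fin_num => //; exact: integrable_on_norm.
Qed.

Lemma cauchy_schwarz f g : Lp A 2 f -> Lp A 2 g ->
  integrable_on A (fun x => f x * g x) /\
  \int[leb2]_(x in A) `|f x * g x| <= Lp_norm A 2 f * Lp_norm A 2 g.
Proof. by apply: Lp_hoelder => //; lra. Qed.

Lemma Lp2_bounded_mul f g (M : R) : measurable_fun A f -> (forall x, A x -> `|f x| <= M) ->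
  Lp A 2 g -> Lp A 2 (fun x => f x * g x).
Proof.
move=> mf fM Lg; apply: integrable_Lp2; first by apply: measurable_funM => //; case: Lg.
apply: (integrable_on_le _ (integrable_onZ (M ^+ 2) (Lp2_integrable Lg))).
  by apply: measurable_funX; apply: measurable_funM => //; case: Lg.
move=> x Ax; rewrite normrX normrM exprMn [leLHS]mulrC [leRHS]mulrC real_normK ?num_real//.
by rewrite ler_wpM2l ?sqr_ge0// lerXn2r ?nnegrE// ?fM// (le_trans (normr_ge0 _) (fM x Ax)).
Qed.

Lemma Lp2B f g : Lp A 2 f -> Lp A 2 g -> Lp A 2 (fun x => f x - g x).
Proof.
move=> Lf Lg; have mf := Lf.1; have mg := Lg.1.
apply: integrable_Lp2; first exact: measurable_funB.
apply: (integrable_on_le _ (integrable_onD (integrable_onZ 2 (Lp2_integrable Lf)) (integrable_onZ 2 (Lp2_integrable Lg)))).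
  by apply: measurable_funX; exact: measurable_funB.
by move=> x Ax; rewrite ger0_norm ?sqr_ge0//; have := sqr_ge0 (f x + g x); lra.
Qed.

Lemma ae_Lp2 f g : measurable_fun A g -> (\forall x \ae leb2, A x -> f x = g x) ->
  Lp A 2 f -> Lp A 2 g.
Proof.
move=> mg fg Lf; apply: integrable_Lp2 => //.
apply: (ae_integrable_on _ _ (Lp2_integrable Lf)); first exact: measurable_funX.
by apply: ae_leb2_imp fg => x h /h ->.
Qed.

End MeasurableSet.
End LpSpaces.

(** * Sobolev spaces *)

Section SobolevSpaces.
Context {R : realType}.
Implicit Types (A : set (plane R)) (f g u v phi : scalar_field R) (i j : 'I_2).

Section MeasurableSet.
Context {A : set (plane R)}.
Hypothesis mA : measurable (A : set (mplane R)).

Lemma measurable_sqrt_comp f : measurable_fun A f -> measurable_fun A (fun x => Num.sqrt (f x)).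
Proof.
move=> mf; apply: (@measurableT_comp _ _ _ _ _ _ (fun t : R => Num.sqrt t)) => //.
by apply: continuous_measurable_fun; exact: sqrt_continuous.
Qed.

Lemma Lp_dominated p f g : 0 < p -> measurable_fun A f -> Lp A p g ->
  (forall x, A x -> `|f x| <= `|g x|) -> Lp A p f.
Proof.
move=> p0 mf Lg fg; apply: integrable_Lp => //.
apply: (integrable_on_le mA _ (Lp_integrable p0 Lg)).
  exact: measurable_powR_norm.
move=> x Ax; rewrite ger0_norm ?powR_ge0//.
by apply: ge0_ler_powR; rewrite ?nnegrE ?fg// ltW.
Qed.

(** The sum is at most twice the larger term. *)
Lemma powRD_le (p a b : R) : 0 < p -> 0 <= a -> 0 <= b ->
  (a + b) `^ p <= 2 `^ p * (a `^ p + b `^ p).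
Proof.
move=> p0; wlog ab : a b / a <= b.
  by move=> h a0 b0; case/orP: (le_total a b) => ab; [|rewrite addrC [X in _ * X]addrC]; exact: h.
move=> a0 b0; apply: (@le_trans _ _ ((2 * b) `^ p)).
  by apply: (ge0_ler_powR (ltW p0)); rewrite ?nnegrE ?addr_ge0 ?mulr_ge0//; lra.
by rewrite powRM// ler_wpM2l ?powR_ge0// lerDr powR_ge0.
Qed.

Lemma Lp_normD p f g : 0 < p -> Lp A p f -> Lp A p g -> Lp A p (fun x => `|f x| + `|g x|).
Proof.
move=> p0 Lf Lg.
have m : measurable_fun A (fun x => `|f x| + `|g x|).
  by apply: measurable_funD; apply: measurableT_comp => //; [case: Lf|case: Lg].
apply: integrable_Lp => //.
apply: (integrable_on_le mA _ (integrable_onZ mA (2 `^ p)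
  (integrable_onD mA (Lp_integrable p0 Lf) (Lp_integrable p0 Lg)))).
  exact: measurable_powR_norm.
move=> x Ax; rewrite ger0_norm ?powR_ge0// (ger0_norm (addr_ge0 _ _))//.
exact: powRD_le.
Qed.

Lemma sqrtD_le (a b : R) : 0 <= a -> 0 <= b -> Num.sqrt (a + b) <= Num.sqrt a + Num.sqrt b.
Proof.
move=> a0 b0; rewrite -ler_sqr ?nnegrE ?addr_ge0 ?sqrtr_ge0//.
rewrite sqr_sqrtr ?addr_ge0// sqrrD !sqr_sqrtr// lerD2r lerDl.
by rewrite mulrn_wge0// mulr_ge0 ?sqrtr_ge0.
Qed.

Lemma Lp_sqrt2 p (F : 'I_2 -> scalar_field R) : 0 < p -> (forall k, Lp A p (F k)) ->
  Lp A p (fun x => Num.sqrt (\sum_k F k x ^+ 2)).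
Proof.
move=> p0 LF; apply: (Lp_dominated p0 _ (Lp_normD p0 (LF ord0) (LF ord_max))).
  apply: measurable_sqrt_comp; apply: measurable_sum => k.
  by apply: measurable_funX; case: (LF k).
move=> x Ax; rewrite big_ord_recl big_ord1 ger0_norm ?sqrtr_ge0//.
rewrite (_ : lift ord0 ord0 = ord_max); last exact: val_inj.
apply: le_trans (sqrtD_le (sqr_ge0 _) (sqr_ge0 _)) _.
by rewrite !sqrtr_sqr (ger0_norm (addr_ge0 _ _)).
Qed.

End MeasurableSet.

#[local] Opaque Rintegral wderiv.

Section OpenSet.
Context {A : set (plane R)}.
Hypothesis oA : open A.
Let mA : measurable (A : set (mplane R)) := open_measurable_plane oA.

Lemma W1p_weakly_derivable p u i : W1p A p u -> weakly_derivable A i u.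
Proof. by move=> [_ /(_ i)[]]. Qed.

Lemma W1p_wderiv p u i : W1p A p u -> Lp A p (wderiv A i u).
Proof. by move=> [_ /(_ i)[]]. Qed.

Lemma measurable_wderiv u i : weakly_derivable A i u -> measurable_fun A (wderiv A i u).
Proof. by move=> /wderivP[_ []]. Qed.

Lemma grad_absE p u : 0 < p -> W1p A p u -> Lp A p (grad_abs A u).
Proof. by move=> p0 hu; apply: Lp_sqrt2 => // j; exact: W1p_wderiv. Qed.

Lemma Lp_vgrad_abs p (v : vector_field R) : 0 < p -> vW1p A p v -> Lp A p (vgrad_abs A v).
Proof.
move=> p0 hv; rewrite (_ : vgrad_abs A v = fun x => Num.sqrt (\sum_i grad_abs A (v i) x ^+ 2)).
  by apply: Lp_sqrt2 => // i; exact: grad_absE.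
apply/funext => x; rewrite /vgrad_abs; congr Num.sqrt; apply: eq_bigr => i _.
by rewrite /grad_abs /enorm sqr_sqrtr// sumr_ge0// => j _; exact: sqr_ge0.
Qed.

Lemma W1p_integrable_wderiv_sqr u j : W1p A 2 u ->
  integrable_on A (fun x => wderiv A j u x ^+ 2).
Proof. by move=> hu; apply: Lp2_integrable => //; exact: W1p_wderiv. Qed.

Lemma grad_norm_sqr u : W1p A 2 u ->
  grad_norm A 2 u ^+ 2 = \sum_j \int[leb2]_(x in A) (wderiv A j u x ^+ 2).
Proof.
move=> hu; rewrite Lp2_norm_sqr//; last exact: grad_absE.
rewrite -Rintegral_sum//; last by move=> j; exact: W1p_integrable_wderiv_sqr.
apply: eq_Rintegral => x _; rewrite /grad_abs /enorm sqr_sqrtr// sumr_ge0// => j _.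
exact: sqr_ge0.
Qed.

Lemma vgrad_norm_sqr (v : vector_field R) : vW1p A 2 v ->
  vgrad_norm A 2 v ^+ 2 = \sum_i grad_norm A 2 (v i) ^+ 2.
Proof.
move=> hv; rewrite Lp2_norm_sqr//; last exact: Lp_vgrad_abs.
transitivity (\sum_i \int[leb2]_(x in A) (\sum_j wderiv A j (v i) x ^+ 2)).
  rewrite -Rintegral_sum//.
    apply: eq_Rintegral => x _; rewrite /vgrad_abs sqr_sqrtr//.
    by apply: sumr_ge0 => i _; apply: sumr_ge0 => j _; exact: sqr_ge0.
  by move=> i; apply: integrable_on_sum => // j; exact: W1p_integrable_wderiv_sqr.
apply: eq_bigr => i _; rewrite grad_norm_sqr// Rintegral_sum// => j.
exact: W1p_integrable_wderiv_sqr.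
Qed.

Lemma W1p2B u v : W1p A 2 u -> W1p A 2 v -> W1p A 2 (fun x => u x - v x).
Proof.
move=> hu hv; split; first by apply: Lp2B => //; [case: hu|case: hv].
move=> i; have du := W1p_weakly_derivable i hu; have dv := W1p_weakly_derivable i hv.
have dw := weakly_derivableB oA du dv; split => //.
apply: (@ae_Lp2 _ _ mA (fun x => wderiv A i u x - wderiv A i v x)).
- exact: measurable_wderiv.
- by apply: ae_leb2_imp (wderivB oA du dv) => x h /h.
- by apply: Lp2B => //; exact: W1p_wderiv.
Qed.

Lemma H1_norm_sqr u : W1p A 2 u -> H1_norm A u ^+ 2 =
  \int[leb2]_(x in A) (u x ^+ 2) + \sum_j \int[leb2]_(x in A) (wderiv A j u x ^+ 2).
Proof.
move=> hu; rewrite /H1_norm sqr_sqrtr ?addr_ge0 ?sqr_ge0//.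
by rewrite grad_norm_sqr// Lp2_norm_sqr//; case: hu.
Qed.

#[local] Opaque Rintegral wderiv H1_norm.

Lemma Rintegral_sqrB_le f g : Lp A 2 f -> Lp A 2 g ->
  \int[leb2]_(x in A) ((f x - g x) ^+ 2) <=
  2 * \int[leb2]_(x in A) (f x ^+ 2) + 2 * \int[leb2]_(x in A) (g x ^+ 2).
Proof.
move=> Lf Lg; have hf := Lp2_integrable mA Lf; have hg := Lp2_integrable mA Lg.
rewrite -!RintegralZl// -RintegralD//; [|exact: integrable_onZ|exact: integrable_onZ].
apply: le_Rintegral => //.
- by apply: (Lp2_integrable mA); exact: Lp2B.
- by apply: (integrable_onD mA); exact: integrable_onZ.
- by move=> x _; have := sqr_ge0 (f x + g x); lra.
Qed.

(** The parallelogram inequality, applied to the function and to its weak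
    derivatives. *)
Lemma H1_normB_le u v : W1p A 2 u -> W1p A 2 v ->
  H1_norm A (fun x => u x - v x) ^+ 2 <= 2 * H1_norm A u ^+ 2 + 2 * H1_norm A v ^+ 2.
Proof.
move=> hu hv; rewrite [X in X <= _](H1_norm_sqr (W1p2B hu hv)).
rewrite [X in _ <= 2 * X + _](H1_norm_sqr hu) [X in _ <= _ + 2 * X](H1_norm_sqr hv).
have E j : \int[leb2]_(x in A) (wderiv A j (fun x => u x - v x) x ^+ 2) =
    \int[leb2]_(x in A) ((wderiv A j u x - wderiv A j v x) ^+ 2).
  have du := W1p_weakly_derivable j hu; have dv := W1p_weakly_derivable j hv.
  apply: eq_ae_Rintegral => //.
  - by apply: measurable_funX; apply: measurable_wderiv; exact: weakly_derivableB.
  - by apply: measurable_funX; apply: measurable_funB; exact: measurable_wderiv.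
  - by apply: ae_leb2_imp (wderivB oA du dv) => x h /h ->.
have h0 := Rintegral_sqrB_le hu.1 hv.1.
have h1 j := Rintegral_sqrB_le (W1p_wderiv j hu) (W1p_wderiv j hv).
under [X in _ + X <= _]eq_bigr => j _ do rewrite E.
have arith (a b c d e l : R) : a <= 2 * b + 2 * c -> d <= 2 * e + 2 * l ->
  a + d <= 2 * (b + e) + 2 * (c + l) by lra.
apply: arith; first exact: h0.
have sum_le (F G H : 'I_2 -> R) : (forall j, F j <= 2 * G j + 2 * H j) ->
  \sum_j F j <= 2 * \sum_j G j + 2 * \sum_j H j.
  by move=> FGH; rewrite !mulr_sumr -big_split; apply: ler_sum => j _; exact: FGH.
by apply: sum_le => j; exact: h1.
Qed.

Lemma test_function_Lp2 phi : test_function A phi -> Lp A 2 phi.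
Proof.
move=> tphi; apply: integrable_Lp2 => //.
  exact: (@measurable_funTS _ _ (mplane R) _ _ _ (test_function_measurable tphi)).
exact: L1loc_test_integrable (L1loc_test tphi) tphi.
Qed.

Lemma test_function_W1p2 phi : test_function A phi -> W1p A 2 phi.
Proof.
move=> tphi; split; first exact: test_function_Lp2.
move=> i; have wd := is_weak_deriv_test oA i tphi.
have dphi : weakly_derivable A i phi by exists ('D_(Defs.basis i) phi).
split => //; apply: (@ae_Lp2 _ _ mA ('D_(Defs.basis i) phi)).
- exact: measurable_wderiv.
- exact: is_weak_deriv_unique wd (wderivP dphi).
- by apply: test_function_Lp2; exact: test_functionD.
Qed.

Lemma lt_of_sqr_le (a b c e : R) : 0 <= a -> 0 <= b -> a < e / 2 -> b < e / 2 ->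
  c ^+ 2 <= 2 * a ^+ 2 + 2 * b ^+ 2 -> c < e.
Proof.
move=> a0 b0 ae be h; rewrite ltNge; apply/negP => ec.
have e0 : 0 < e by lra.
have : e ^+ 2 <= c ^+ 2 by rewrite lerXn2r ?nnegrE//; lra.
by nra.
Qed.

(** The approximating test functions are subtracted. Their classical derivatives
    are their weak derivatives, so the [H1_norm] of [u - phi] is an honest norm
    and not the default value for functions without weak derivatives. *)
Lemma H10B u v : H10 A u -> H10 A v -> H10 A (fun x => u x - v x).
Proof.
move=> [hu du] [hv dv]; split; first exact: W1p2B.
move=> e e0; have e2 : 0 < e / 2 by rewrite divr_gt0.
have [phi tphi hphi] := du _ e2; have [psi tpsi hpsi] := dv _ e2.
exists (phi - psi); first exact: test_functionB.
rewrite (_ : (fun x => _) = fun x => (u x - phi x) - (v x - psi x)); last first.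
  apply/funext => x; have subACA (a b c d : R) : a - b - (c - d) = a - c - (b - d) by ring.
  exact: subACA.
have Wp := W1p2B hu (test_function_W1p2 tphi).
have Wq := W1p2B hv (test_function_W1p2 tpsi).
exact: lt_of_sqr_le (sqrtr_ge0 _) (sqrtr_ge0 _) hphi hpsi (H1_normB_le Wp Wq).
Qed.

End OpenSet.
End SobolevSpaces.

(** * Bounded functions and discrete spaces *)

#[local] Opaque Rintegral wderiv H1_norm grad_norm vgrad_norm Lp_norm.

Section DiscreteSpaces.
Context {R : realType}.
Implicit Types (K : set (plane R)) (f g u v phi : scalar_field R) (i j : 'I_2).
Context {A : set (plane R)}.
Hypothesis oA : open A.
Hypothesis bA : bounded_set A.
Let mA : measurable (A : set (mplane R)) := open_measurable_plane oA.

Definition bounded_fun f := measurable_fun A f /\ exists M, forall x, A x -> `|f x| <= M.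

Lemma bounded_fun_integrable f : bounded_fun f -> integrable_on A f.
Proof.
move=> [mf [M hM]]; apply: measurable_bounded_integrable => //.
  exact: bounded_leb2_lty.
exists M; split; first exact: num_real.
by move=> y My x Ax /=; exact: le_trans (hM x Ax) (ltW My).
Qed.

Lemma bounded_funM f g : bounded_fun f -> bounded_fun g -> bounded_fun (fun x => f x * g x).
Proof.
move=> [mf [M hM]] [mg [N hN]]; split; first exact: measurable_funM.
by exists (M * N) => x Ax; rewrite normrM ler_pM ?hM ?hN.
Qed.

Lemma bounded_funD f g : bounded_fun f -> bounded_fun g -> bounded_fun (fun x => f x + g x).
Proof.
move=> [mf [M hM]] [mg [N hN]]; split; first exact: measurable_funD.
by exists (M + N) => x Ax; rewrite (le_trans (ler_normD _ _))// lerD ?hM ?hN.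
Qed.

Lemma bounded_funN f : bounded_fun f -> bounded_fun (fun x => - f x).
Proof.
move=> [mf [M hM]]; split; first exact: measurableT_comp.
by exists M => x Ax; rewrite normrN hM.
Qed.

Lemma bounded_fun_sum (F : 'I_2 -> scalar_field R) :
  (forall i, bounded_fun (F i)) -> bounded_fun (fun x => \sum_i F i x).
Proof.
move=> hF; rewrite (_ : (fun x => _) = fun x => F ord0 x + F (lift ord0 ord0) x).
  exact: bounded_funD.
by apply/funext => x; rewrite big_ord_recl big_ord1.
Qed.

Lemma bounded_fun_Lp p f : 0 < p -> bounded_fun f -> Lp A p f.
Proof.
move=> p0 [mf [M hM]]; apply: integrable_Lp => //.
apply: bounded_fun_integrable; split; first exact: measurable_powR_norm.
exists (M `^ p) => x Ax; rewrite ger0_norm ?powR_ge0//.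
by apply: (ge0_ler_powR (ltW p0)); rewrite ?nnegrE ?hM// (le_trans _ (hM x Ax)).
Qed.

Lemma bounded_funM_Lp2 f g : bounded_fun f -> Lp A 2 g -> Lp A 2 (fun x => f x * g x).
Proof. by move=> [mf [M hM]]; exact: Lp2_bounded_mul hM. Qed.

Lemma Lp2_integrable1 f : Lp A 2 f -> integrable_on A f.
Proof.
move=> Lf; have b1 : bounded_fun (cst 1).
  by split; [exact: measurable_cst|exists 1 => x _; rewrite normr1].
have [+ _] := cauchy_schwarz mA Lf (bounded_fun_Lp (ltr0Sn _ 1) b1).
by apply: eq_integrable => // x _ /=; rewrite mulr1.
Qed.

Lemma Lp2_sum (F : 'I_2 -> scalar_field R) :
  (forall i, Lp A 2 (F i)) -> Lp A 2 (fun x => \sum_i F i x).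
Proof.
move=> hF; rewrite (_ : (fun x => _) = fun x => F ord0 x - ((fun x => - 1) x * F (lift ord0 ord0) x)).
  apply: (Lp2B mA) => //; apply: bounded_funM_Lp2 => //.
  by split; [exact: measurable_cst|exists 1 => x _; rewrite normrN normr1].
by apply/funext => x; rewrite big_ord_recl big_ord1 mulN1r opprK.
Qed.

Lemma bounded_funM_integrable f g : bounded_fun f -> integrable_on A g ->
  integrable_on A (fun x => f x * g x).
Proof.
move=> [mf [M hM]] ig.
have M1 x : A x -> `|f x * g x| <= M * `|g x| by move=> Ax; rewrite normrM ler_wpM2r ?hM.
apply: (integrable_on_le mA _ (integrable_onZ mA M (integrable_on_norm ig)) M1).
by apply: measurable_funM => //; exact: integrable_on_measurable.
Qed.

(** Finite element functions are continuous on the compact set [closure A], hence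
    bounded. Together with square integrable gradients this makes all terms of
    the discrete problem integrable. *)
Lemma bounded_fun_within f : measurable_fun A f -> {within closure A, continuous f} -> bounded_fun f.
Proof.
move=> mf cf; split => //.
have [M [_ hM]] : bounded_set (f @` closure A).
  by apply: compact_bounded; apply: continuous_compact => //; exact: compact_closure_bounded.
exists (`|M| + 1) => x Ax; apply: (hM (`|M| + 1)); last by exists x => //; exact: subset_closure.
by rewrite (le_lt_trans (ler_norm _))// ltrDl.
Qed.

Lemma within_continuousB (D : set (plane R)) f g : {within D, continuous f} -> {within D, continuous g} ->
  {within D, continuous (fun x => f x - g x)}.
Proof. by move=> cf cg x; apply: cvgB; [exact: cf|exact: cg]. Qed.

Lemma poly_onB k K f g : poly_on k K f -> poly_on k K g -> poly_on k K (fun x => f x - g x).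
Proof.
move=> [c hc] [d hd]; exists (fun i j : nat => c i j - d i j) => x Kx.
rewrite hc// hd// -sumrB; apply: eq_bigr => i _; rewrite -sumrB; apply: eq_bigr => j _.
by rewrite !mulrBl.
Qed.

Lemma local_velocityB fe K f g : local_velocity fe K f -> local_velocity fe K g ->
  local_velocity fe K (fun x => f x - g x).
Proof.
case: fe => [|b]; first exact: poly_onB.
move=> [p [c [pp hf]]] [q [d [pq hg]]]; exists (fun x => p x - q x), (c - d).
split; first exact: poly_onB.
by move=> x Kx; rewrite hf// hg//; ring.
Qed.

Lemma vH10B (u v : vector_field R) : vH10 A u -> vH10 A v ->
  vH10 A (fun i x => u i x - v i x).
Proof. by move=> hu hv i; exact: H10B. Qed.

Lemma XhB fe T (u v : vector_field R) : Xh fe A T u -> Xh fe A T v ->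
  Xh fe A T (fun i x => u i x - v i x).
Proof.
move=> [cu lu hu] [cv lv hv]; split; last exact: vH10B.
  by move=> i; apply: within_continuousB.
by move=> i K TK; apply: local_velocityB; [exact: lu|exact: lv].
Qed.

Lemma YhB fe T f g : Yh fe A T f -> Yh fe A T g -> Yh fe A T (fun x => f x - g x).
Proof.
move=> [cf lf hf] [cg lg hg]; split; last exact: H10B.
  exact: within_continuousB.
by move=> K TK; apply: poly_onB; [exact: lf|exact: lg].
Qed.

Lemma MhB T f g : Mh A T f -> Mh A T g -> Mh A T (fun x => f x - g x).
Proof.
move=> [cf lf hf f0] [cg lg hg g0]; split.
- exact: within_continuousB.
- by move=> K TK; apply: poly_onB; [exact: lf|exact: lg].
- exact: Lp2B.
- have iF := Lp2_integrable1 hf; have iG := Lp2_integrable1 hg.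
  by rewrite RintegralB// f0 g0 subrr.
Qed.

Lemma H10_Lp2 u j : H10 A u -> Lp A 2 (wderiv A j u).
Proof. by move=> [hu _]; exact: W1p_wderiv. Qed.

Lemma H10_measurable u : H10 A u -> measurable_fun A u.
Proof. by move=> [[[]]]. Qed.

Lemma Xh_bounded fe T (u : vector_field R) i : Xh fe A T u -> bounded_fun (u i).
Proof. by move=> [cu _ hu]; apply: bounded_fun_within => //; exact: H10_measurable. Qed.

Lemma Yh_bounded fe T f : Yh fe A T f -> bounded_fun f.
Proof. by move=> [cu _ hu]; apply: bounded_fun_within => //; exact: H10_measurable. Qed.

Lemma Mh_bounded T f : Mh A T f -> bounded_fun f.
Proof. by move=> [cu _ [hu _] _]; exact: bounded_fun_within. Qed.

Lemma lipschitz_dist (k : R -> R) (L : R) : L.-lipschitz k ->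
  forall x y, `|k x - k y| <= L * `|x - y|.
Proof. by move=> h x y; exact: (h (x, y)). Qed.

Lemma lipschitz_ge0 (k : R -> R) (L : R) : L.-lipschitz k -> 0 <= L.
Proof.
move=> /lipschitz_dist/(_ 1 0); rewrite subr0 normr1 mulr1.
exact: le_trans.
Qed.

Lemma lipschitz_cont (k : R -> R) (L : R) : L.-lipschitz k -> continuous k.
Proof.
move=> hk x; have L0 := lipschitz_ge0 hk; apply/cvgrPdist_lt => e e0.
have L1 : 0 < L + 1 by rewrite ltr_wpDl.
apply/nbhs_ballP; exists (e / (L + 1)) => /=; first by rewrite divr_gt0.
move=> y; rewrite /ball/= ltr_pdivlMr// => h; apply: le_lt_trans (lipschitz_dist hk x y) _.
by apply: le_lt_trans h; rewrite mulrDr mulr1 mulrC lerDl.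
Qed.

Lemma lipschitz_bounded_comp (k : R -> R) (L m M : R) f : L.-lipschitz k ->
  (forall r, m <= k r <= M) -> 0 < m -> measurable_fun A f -> bounded_fun (k \o f).
Proof.
move=> Lk mk m0 mf; split.
  apply: measurableT_comp => //; apply: continuous_measurable_fun.
  exact: lipschitz_cont Lk.
exists M => x _ /=; have /andP[h1 h2] := mk (f x).
by rewrite ger0_norm// ltW// (lt_le_trans m0).
Qed.

Lemma H10B_wderiv u v : H10 A u -> H10 A v ->
  \forall x \ae leb2, A x -> forall j,
    wderiv A j (fun x => u x - v x) x = wderiv A j u x - wderiv A j v x.
Proof.
move=> [hu _] [hv _].
have h j := wderivB oA (W1p_weakly_derivable j hu) (W1p_weakly_derivable j hv).
apply: ae_leb2_imp (ae_forall_ord2 h) => x {}h Ax j; exact: h.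
Qed.

Lemma vH10B_wderiv (u v : vector_field R) : vH10 A u -> vH10 A v ->
  \forall x \ae leb2, A x -> forall i j,
    wderiv A j (fun x => u i x - v i x) x = wderiv A j (u i) x - wderiv A j (v i) x.
Proof.
move=> hu hv; have h i := H10B_wderiv (hu i) (hv i).
by apply: ae_leb2_imp (ae_forall_ord2 h) => x {}h Ax i; exact: h.
Qed.

End DiscreteSpaces.

(** * Hölder bounds for gradients *)

Section Inequalities.
Context {R : realType}.
Implicit Types (f g u v t : scalar_field R) (i j : 'I_2) (p q r : R).

Lemma enorm_ge0 (a : 'I_2 -> R) : 0 <= enorm a. Proof. exact: sqrtr_ge0. Qed.

Lemma enorm_sqr (a : 'I_2 -> R) : enorm a ^+ 2 = \sum_i a i ^+ 2.
Proof. by rewrite sqr_sqrtr// sumr_ge0// => i _; exact: sqr_ge0. Qed.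

Lemma sum_le_enorm (a b : 'I_2 -> R) : `|\sum_j a j * b j| <= enorm a * enorm b.
Proof.
rewrite -ler_sqr ?nnegrE ?mulr_ge0 ?enorm_ge0// exprMn !enorm_sqr.
rewrite real_normK ?num_real// !big_ord_recl !big_ord0 !addr0.
set a0 := a _; set a1 := a (lift _ _); set b0 := b _; set b1 := b (lift _ _).
by rewrite -subr_ge0 (_ : _ - _ = (a0 * b1 - a1 * b0) ^+ 2) ?sqr_ge0//; ring.
Qed.

Section OpenSet.
Context {A : set (plane R)}.
Hypothesis oA : open A.
Hypothesis bA : bounded_set A.
Let mA : measurable (A : set (mplane R)) := open_measurable_plane oA.

Definition gdot u v : scalar_field R := fun x => \sum_j wderiv A j u x * wderiv A j v x.

Definition vgdot (u v : vector_field R) : scalar_field R :=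
  fun x => \sum_i \sum_j wderiv A j (u i) x * wderiv A j (v i) x.

Lemma grad_abs_ge0 u x : 0 <= grad_abs A u x. Proof. exact: sqrtr_ge0. Qed.

Lemma vgrad_abs_ge0 (u : vector_field R) x : 0 <= vgrad_abs A u x.
Proof. exact: sqrtr_ge0. Qed.

Lemma gdot_le u v x : `|gdot u v x| <= grad_abs A u x * grad_abs A v x.
Proof. exact: sum_le_enorm. Qed.

Lemma vgrad_absE (u : vector_field R) x : vgrad_abs A u x = enorm (fun i => grad_abs A (u i) x).
Proof.
rewrite /vgrad_abs /enorm; congr Num.sqrt; apply: eq_bigr => i _.
by rewrite enorm_sqr.
Qed.

Lemma vgdot_le (u v : vector_field R) x :
  `|vgdot u v x| <= vgrad_abs A u x * vgrad_abs A v x.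
Proof.
rewrite !vgrad_absE; apply: le_trans (sum_le_enorm _ _).
apply: le_trans (ler_norm_sum _ _ _) _; rewrite ger0_norm; last first.
  by apply: sumr_ge0 => i _; rewrite mulr_ge0 ?grad_abs_ge0.
by apply: ler_sum => i _; exact: gdot_le.
Qed.

Lemma gdot_self u x : gdot u u x = grad_abs A u x ^+ 2.
Proof. by rewrite enorm_sqr; apply: eq_bigr => j _; rewrite expr2. Qed.

Lemma vgdot_self (u : vector_field R) x : vgdot u u x = vgrad_abs A u x ^+ 2.
Proof.
rewrite vgrad_absE enorm_sqr; apply: eq_bigr => i _.
exact: gdot_self.
Qed.

Lemma gdot_integrable u v : H10 A u -> H10 A v -> integrable_on A (gdot u v).
Proof.
move=> hu hv; apply: (integrable_on_sum mA) => j.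
by have [] := cauchy_schwarz mA (H10_Lp2 j hu) (H10_Lp2 j hv).
Qed.

Lemma vgdot_integrable (u v : vector_field R) : vH10 A u -> vH10 A v ->
  integrable_on A (vgdot u v).
Proof.
by move=> hu hv; apply: (integrable_on_sum mA) => i; exact: gdot_integrable.
Qed.

Lemma Rintegral_coercive (c G : scalar_field R) (m : R) : bounded_fun (A := A) c ->
  (forall x, A x -> m <= c x) -> Lp A 2 G ->
  m * Lp_norm A 2 G ^+ 2 <= \int[leb2]_(x in A) (c x * G x ^+ 2).
Proof.
move=> bc mc LG; have iG := Lp2_integrable mA LG.
rewrite [X in m * X](Lp2_norm_sqr LG) -RintegralZl//; apply: le_Rintegral => //.
- exact: integrable_onZ.
- exact: bounded_funM_integrable.
- by move=> x Ax; rewrite ler_wpM2r ?sqr_ge0// mc.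
Qed.

Lemma Lp_norm_sqr (P : R) f : 0 < P -> Lp A (2 * P) f ->
  Lp A P (fun x => f x ^+ 2) /\ Lp_norm A P (fun x => f x ^+ 2) = Lp_norm A (2 * P) f ^+ 2.
Proof.
move=> P0 Lf; have P20 : 0 < 2 * P by rewrite mulr_gt0.
have E x : `|f x ^+ 2| `^ P = `|f x| `^ (2 * P).
  by rewrite normrX -powR_mulrn// powRrM.
have Lf2 : Lp A P (fun x => f x ^+ 2).
  apply: integrable_Lp => //; first by apply: measurable_funX; case: Lf.
  by rewrite (_ : (fun x => _) = fun x => `|f x| `^ (2 * P)); [exact: Lp_integrable|exact/funext].
split => //.
have h : Lp_norm A P (fun x => f x ^+ 2) `^ P = (Lp_norm A (2 * P) f ^+ 2) `^ P.
  rewrite (Lp_norm_powE P0 Lf2) -powR_mulrn ?Lp_norm_ge0// -powRrM (Lp_norm_powE P20 Lf).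
  by apply: eq_Rintegral => x _; rewrite E.
have := congr1 (fun z => z `^ P^-1) h.
by rewrite -!powRrM mulfV ?gt_eqF// !powRr1// ?sqr_ge0 ?Lp_norm_ge0.
Qed.

(** Hölder's inequality for the squares. *)
Lemma Lp2_mul (P Q : R) f g : 0 < P -> 0 < Q -> P^-1 + Q^-1 = 1 ->
  Lp A (2 * P) f -> Lp A (2 * Q) g ->
  Lp A 2 (fun x => f x * g x) /\
  Lp_norm A 2 (fun x => f x * g x) <= Lp_norm A (2 * P) f * Lp_norm A (2 * Q) g.
Proof.
move=> P0 Q0 PQ Lf Lg.
have [Lf2 fE] := Lp_norm_sqr P0 Lf; have [Lg2 gE] := Lp_norm_sqr Q0 Lg.
have [ifg hfg] := Lp_hoelder mA P0 Q0 PQ Lf2 Lg2.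
have Lfg : Lp A 2 (fun x => f x * g x).
  apply: (integrable_Lp2 mA); first by apply: measurable_funM; [case: Lf|case: Lg].
  by apply: eq_integrable ifg => // x _ /=; rewrite exprMn.
split => //; rewrite -ler_sqr ?nnegrE ?mulr_ge0 ?Lp_norm_ge0//.
rewrite [X in X <= _](Lp2_norm_sqr Lfg) exprMn -fE -gE; apply: le_trans hfg.
rewrite le_eqVlt; apply/orP; left; apply/eqP; apply: eq_Rintegral => x _.
by rewrite exprMn ger0_norm// mulr_ge0// sqr_ge0.
Qed.

Lemma Rintegral_le_norm f g (M : R) : integrable_on A f -> integrable_on A g ->
  (forall x, A x -> `|f x| <= g x) -> \int[leb2]_(x in A) g x <= M ->
  `|\int[leb2]_(x in A) f x| <= M.
Proof.
move=> hf hg fg gM; apply: le_trans (le_normr_Rintegral mA hf) _.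
apply: le_trans gM; apply: le_Rintegral => //; exact: integrable_on_norm.
Qed.

Lemma Rintegral_le_Lp2 f (G H : scalar_field R) : integrable_on A f ->
  Lp A 2 G -> Lp A 2 H -> (forall x, A x -> `|f x| <= `|G x * H x|) ->
  `|\int[leb2]_(x in A) f x| <= Lp_norm A 2 G * Lp_norm A 2 H.
Proof.
move=> hf LG LH fGH; have [iGH hGH] := cauchy_schwarz mA LG LH.
by apply: (Rintegral_le_norm hf _ fGH) => //; exact: integrable_on_norm.
Qed.

Lemma embedding_Lp p C u : is_embedding_const A p C -> H10 A u ->
  Lp A p u /\ Lp_norm A p u <= C * grad_norm A 2 u.
Proof.
move=> [C0 hC] hu; have h := hC u hu.
have fin : (eLp_norm A p u < +oo)%E by apply: le_lt_trans h _; rewrite ltry.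
split; first by split => //; exact: H10_measurable.
rewrite -lee_fin; apply: le_trans h.
by rewrite Lp_norm_fineK.
Qed.

Lemma embedding_const_ge0 p C : is_embedding_const A p C -> 0 <= C.
Proof. by case. Qed.

Lemma vgrad_norm_ge0 p (u : vector_field R) : 0 <= vgrad_norm A p u.
Proof. exact: Lp_norm_ge0. Qed.

Lemma grad_norm_ge0 p u : 0 <= grad_norm A p u.
Proof. exact: Lp_norm_ge0. Qed.

Lemma H10_grad_abs u : H10 A u -> Lp A 2 (grad_abs A u).
Proof. by move=> [hu _]; apply: grad_absE. Qed.

Lemma vH10_W1p (u : vector_field R) : vH10 A u -> vW1p A 2 u.
Proof. by move=> hu i; case: (hu i). Qed.

Lemma vH10_vgrad_abs (u : vector_field R) : vH10 A u -> Lp A 2 (vgrad_abs A u).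
Proof. by move=> hu; apply: Lp_vgrad_abs => //; exact: vH10_W1p. Qed.

(** The conjugate exponents whose doubles are the two exponents of the
    smallness assumption. *)
Lemma sobolev_exponents (eps : R) : 0 < eps ->
  [/\ 0 < (2 + eps) / eps, 0 < (2 + eps) / 2,
      ((2 + eps) / eps)^-1 + ((2 + eps) / 2)^-1 = 1,
      2 * ((2 + eps) / eps) = 2 * (2 + eps) / eps & 2 * ((2 + eps) / 2) = 2 + eps].
Proof.
move=> e0; have e2 : 0 < 2 + eps by rewrite addr_gt0.
split; rewrite ?divr_gt0//; first by field; rewrite !gt_eqF.
- by rewrite mulrA.
- by field.
Qed.

(** The effect of a perturbation [t] of the temperature on a diffusion
    coefficient [c]. Hölder's inequality with the exponents [2 (2 + eps) / eps],
    [2 + eps] and [2] separates [t], which the embedding controls by its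
    gradient, from the gradients [G1] and [G2] that bound [X]. *)
Lemma lipschitz_coefficient_bound (eps C L : R) t (c X G1 G2 : scalar_field R) :
  0 < eps -> is_embedding_const A (2 * (2 + eps) / eps) C -> 0 <= L -> H10 A t ->
  Lp A (2 + eps) G1 -> Lp A 2 G2 -> integrable_on A (fun x => c x * X x) ->
  (forall x, A x -> `|c x| <= L * `|t x|) ->
  (forall x, A x -> `|X x| <= `|G1 x| * `|G2 x|) ->
  `|\int[leb2]_(x in A) (c x * X x)| <=
    L * C * Lp_norm A (2 + eps) G1 * grad_norm A 2 t * Lp_norm A 2 G2.
Proof.
move=> e0 hC L0 ht LG1 LG2 icX ct XG.
have [P0 Q0 PQ PE QE] := sobolev_exponents e0.
have [Lt nt] := embedding_Lp hC ht.
rewrite -PE in Lt nt; rewrite -{1}QE in LG1.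
have [LtG ntG] := Lp2_mul P0 Q0 PQ Lt LG1.
have [itGG ntGG] := cauchy_schwarz mA LtG LG2.
apply: (Rintegral_le_norm icX (g := fun x => L * `|t x * G1 x * G2 x|)).
- apply: (integrable_onZ mA); exact: integrable_on_norm.
- move=> x Ax; rewrite !normrM -(mulrA `|t x|) (mulrA L).
  by apply: ler_pM => //; [exact: ct|exact: XG].
rewrite RintegralZl//; last exact: integrable_on_norm.
have arith (I a b k n1 n2 n3 : R) : 0 <= n1 -> 0 <= n2 -> I <= a * n2 -> a <= b * n1 -> b <= k * n3 ->
    L * I <= L * k * n1 * n3 * n2.
  move=> n10 n20 h1 h2 h3.
  have h4 : b * n1 <= k * n3 * n1 by rewrite ler_wpM2r.
  have h5 : a * n2 <= k * n3 * n1 * n2 by rewrite ler_wpM2r// (le_trans h2).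
  have -> : L * k * n1 * n3 * n2 = L * (k * n3 * n1 * n2) by ring.
  by rewrite ler_wpM2l// (le_trans h1).
apply: (arith _ _ _ _ _ _ _ _ _ ntGG _ nt); rewrite ?Lp_norm_ge0//.
by move: ntG; rewrite QE.
Qed.

End OpenSet.
End Inequalities.

(** * Dual norms *)

Section DualNorms.
Context {R : realType}.
Context {A : set (plane R)}.

Lemma sup_quotient_ge0 (T : Type) (P : set T) (F N : T -> R) :
  (forall v, 0 <= N v) -> 0 <= sup [set `|F v| / N v | v in P].
Proof.
move=> N0; set S := [set _ | _ in _].
have S0 x : S x -> 0 <= x by move=> [v _ <-]; rewrite divr_ge0.
have [hS|/sup_out ->//] := pselect (has_sup S); have [[x Sx] Sub] := hS.
by apply: le_trans (S0 x Sx) _; exact: sup_ubound.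
Qed.

Lemma le_sup_quotient (T : Type) (P : set T) (F N : T -> R) (C : R) v :
  (forall v, 0 <= N v) -> (forall v, P v -> `|F v| <= C * N v) -> P v ->
  `|F v| <= sup [set `|F v| / N v | v in [set v | P v /\ N v != 0]] * N v.
Proof.
move=> N0 hC Pv; have [Nv0|Nv0] := eqVneq (N v) 0.
  by rewrite Nv0 mulr0; have := hC v Pv; rewrite Nv0 mulr0.
have Nv : 0 < N v by rewrite lt_def Nv0 N0.
rewrite -ler_pdivrMr//; apply: sup_ubound; last by exists v.
exists C => _ [w [Pw Nw] <-].
by rewrite ler_pdivrMr ?hC// lt_def Nw N0.
Qed.

Lemma Hm1_norm_ge0 (F : scalar_field R -> R) : 0 <= Hm1_norm A F.
Proof. by apply: sup_quotient_ge0 => v; exact: grad_norm_ge0. Qed.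

Lemma vHm1_norm_ge0 (F : vector_field R -> R) : 0 <= vHm1_norm A F.
Proof. by apply: sup_quotient_ge0 => v; exact: vgrad_norm_ge0. Qed.

Lemma le_Hm1_norm (F : scalar_field R -> R) v : Hm1 A F -> H10 A v ->
  `|F v| <= Hm1_norm A F * grad_norm A 2 v.
Proof.
by move=> [_ [C hC]] hv; apply: le_sup_quotient hC hv => w; exact: grad_norm_ge0.
Qed.

Lemma le_vHm1_norm (F : vector_field R -> R) v : vHm1 A F -> vH10 A v ->
  `|F v| <= vHm1_norm A F * vgrad_norm A 2 v.
Proof.
by move=> [_ [C hC]] hv; apply: le_sup_quotient hC hv => w; exact: vgrad_norm_ge0.
Qed.

End DualNorms.

(** * Convection forms *)

Section ConvectionForms.
Context {R : realType}.
Implicit Types (f g u v t T S : scalar_field R) (i j : 'I_2).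
Context {A : set (plane R)}.
Hypothesis oA : open A.
Hypothesis bA : bounded_set A.
Let mA : measurable (A : set (mplane R)) := open_measurable_plane oA.

Definition bounded_H10 u := H10 A u /\ bounded_fun (A := A) u.

Definition vbounded_H10 (u : vector_field R) := forall i, bounded_H10 (u i).

Lemma bounded_H10B u v : bounded_H10 u -> bounded_H10 v -> bounded_H10 (fun x => u x - v x).
Proof.
move=> [hu bu] [hv bv]; split; first exact: H10B.
exact: bounded_funD (bounded_funN bv).
Qed.

Lemma vbounded_H10B (u v : vector_field R) : vbounded_H10 u -> vbounded_H10 v ->
  vbounded_H10 (fun i x => u i x - v i x).
Proof. by move=> hu hv i; exact: bounded_H10B. Qed.

Lemma vbounded_vH10 (u : vector_field R) : vbounded_H10 u -> vH10 A u.
Proof. by move=> hu i; case: (hu i). Qed.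

Definition advect (v : vector_field R) T S : scalar_field R :=
  fun x => (\sum_j v j x * wderiv A j T x) * S x.

Definition conv (v : vector_field R) T S := \int[leb2]_(x in A) advect v T S x.

Lemma advect_integrable (v : vector_field R) T S : vbounded_H10 v -> H10 A T -> bounded_fun (A := A) S ->
  integrable_on A (advect v T S).
Proof.
move=> hv hT bS; apply: (Lp2_integrable1 oA bA).
rewrite (_ : advect v T S = fun x => S x * \sum_j v j x * wderiv A j T x).
  apply: (bounded_funM_Lp2 oA) => //; apply: (Lp2_sum oA) => j.
  by apply: (bounded_funM_Lp2 oA); [case: (hv j)|exact: H10_Lp2].
by apply/funext => x; rewrite mulrC.
Qed.

Lemma convBl (v w : vector_field R) T S : vbounded_H10 v -> vbounded_H10 w -> bounded_H10 T -> bounded_H10 S ->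
  conv (fun i x => v i x - w i x) T S = conv v T S - conv w T S.
Proof.
move=> hv hw [hT _] [_ bS]; rewrite /conv -RintegralB//; [|exact: advect_integrable..].
apply: eq_Rintegral => x _; rewrite /advect -mulrBl -sumrB; congr (_ * _).
by apply: eq_bigr => j _; rewrite mulrBl.
Qed.

Lemma convBr (v : vector_field R) T S S' : vbounded_H10 v -> bounded_H10 T -> bounded_H10 S -> bounded_H10 S' ->
  conv v T (fun x => S x - S' x) = conv v T S - conv v T S'.
Proof.
move=> hv [hT _] [_ bS] [_ bS']; rewrite /conv -RintegralB//; [|exact: advect_integrable..].
by apply: eq_Rintegral => x _; rewrite /advect mulrBr.
Qed.

Lemma advectBm_ae (v : vector_field R) T T' S : H10 A T -> H10 A T' -> \forall x \ae leb2, A x ->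
  advect v (fun x => T x - T' x) S x = advect v T S x - advect v T' S x.
Proof.
move=> hT hT'; apply: ae_leb2_imp (H10B_wderiv oA hT hT') => x h Ax.
rewrite /advect -mulrBl -sumrB; congr (_ * _).
by apply: eq_bigr => j _; rewrite h// mulrBr.
Qed.

Lemma convBm (v : vector_field R) T T' S : vbounded_H10 v -> bounded_H10 T -> bounded_H10 T' -> bounded_H10 S ->
  conv v (fun x => T x - T' x) S = conv v T S - conv v T' S.
Proof.
move=> hv [hT bT] [hT' bT'] [hS bS]; rewrite /conv -RintegralB//; [|exact: advect_integrable..].
apply: (eq_ae_Rintegral mA); last exact: advectBm_ae.
- exact: (integrable_on_measurable (advect_integrable hv (H10B oA hT hT') bS)).
- exact: (integrable_on_measurable (integrable_onB mA (advect_integrable hv hT bS) (advect_integrable hv hT' bS))).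
Qed.

Lemma aST_conv (v : vector_field R) T S : vbounded_H10 v -> bounded_H10 T -> bounded_H10 S ->
  aST A v T S = 2^-1 * (conv v T S - conv v S T).
Proof.
by move=> hv [hT bT] [hS bS]; rewrite /conv -RintegralB//; exact: advect_integrable.
Qed.

Lemma aN_conv (u v w : vector_field R) : vbounded_H10 u -> vbounded_H10 v -> vbounded_H10 w ->
  aN A u v w = \sum_i conv u (v i) (w i).
Proof.
move=> hu hv hw; rewrite -Rintegral_sum// => i.
by apply: advect_integrable => //; [case: (hv i)|case: (hw i)].
Qed.

(** Hölder's inequality with the exponents 4, 2 and 4. The product [v * S] is
    estimated in [L2] component by component, so that the embedding constant for
    scalar functions serves for vector fields too. *)
Lemma conv_bound C (v : vector_field R) T S : is_embedding_const A 4 C ->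
  vbounded_H10 v -> bounded_H10 T -> bounded_H10 S ->
  `|conv v T S| <= C ^+ 2 * vgrad_norm A 2 v * grad_norm A 2 T * grad_norm A 2 S.
Proof.
move=> hC hv [hT bT] [hS bS].
have hC2 : is_embedding_const A (2 * 2) C by rewrite (_ : 2 * 2 = 4 :> R)//; lra.
have conj2 : 2^-1 + 2^-1 = 1 :> R by lra.
have LvS j := Lp2_mul oA (ltr0Sn R 1) (ltr0Sn R 1) conj2
  (embedding_Lp hC2 (vbounded_vH10 hv j)).1 (embedding_Lp hC2 hS).1.
pose G x := Num.sqrt (\sum_j (v j x * S x) ^+ 2).
have LG : Lp A 2 G by apply: (Lp_sqrt2 mA) => // j; case: (LvS j).
have nG : Lp_norm A 2 G <= C ^+ 2 * vgrad_norm A 2 v * grad_norm A 2 S.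
  have C0 := embedding_const_ge0 hC.
  rewrite -ler_sqr ?nnegrE ?mulr_ge0 ?Lp_norm_ge0 ?sqr_ge0 ?vgrad_norm_ge0 ?grad_norm_ge0//.
  rewrite [X in X <= _](Lp2_norm_sqr LG).
  rewrite (_ : Rintegral _ _ _ = \sum_j Lp_norm A 2 (fun x => v j x * S x) ^+ 2); last first.
    transitivity (\int[leb2]_(x in A) \sum_j (v j x * S x) ^+ 2).
      apply: eq_Rintegral => x _; rewrite sqr_sqrtr//.
      by apply: sumr_ge0 => j _; exact: sqr_ge0.
    rewrite Rintegral_sum//; last by move=> j; apply: (Lp2_integrable mA); case: (LvS j).
    by apply: eq_bigr => j _; rewrite [RHS]Lp2_norm_sqr//; case: (LvS j).
  rewrite exprMn [X in _ <= X * _]exprMn [X in _ <= _ * X * _](vgrad_norm_sqr oA (vH10_W1p (vbounded_vH10 hv))).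
  rewrite mulr_sumr mulr_suml; apply: ler_sum => j _.
  have [_ h] := LvS j.
  have [_ h1] := embedding_Lp hC2 (vbounded_vH10 hv j).
  have [_ h2] := embedding_Lp hC2 hS.
  have arith (a b c k l m : R) : 0 <= a -> 0 <= b -> 0 <= c -> a <= b * c -> b <= C * l -> c <= C * m ->
      a ^+ 2 <= (C ^+ 2) ^+ 2 * l ^+ 2 * m ^+ 2.
    move=> a0 b0 c0 abc bl cm.
    have : a <= (C * l) * (C * m) by apply: le_trans abc _; rewrite ler_pM.
    move=> /(@lerXn2r _ 2 a ((C * l) * (C * m))); rewrite !nnegrE => /(_ a0).
    rewrite (le_trans a0 (le_trans abc (ler_pM b0 c0 bl cm))) => /(_ isT).
    by congr (_ <= _); ring.
  by apply: (arith _ _ _ 0 _ _ _ _ _ h h1 h2); exact: Lp_norm_ge0.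
have LT := H10_grad_abs oA hT.
have := Rintegral_le_Lp2 oA (advect_integrable hv hT bS) LG LT.
have pt x : A x -> `|advect v T S x| <= `|G x * grad_abs A T x|.
  move=> _; rewrite [X in _ <= X]ger0_norm ?mulr_ge0 ?sqrtr_ge0//.
  rewrite /advect mulr_suml.
  have -> : \sum_j v j x * wderiv A j T x * S x = \sum_j (v j x * S x) * wderiv A j T x.
    by apply: eq_bigr => j _; rewrite mulrAC.
  exact: sum_le_enorm.
move=> /(_ pt) h; apply: le_trans h _.
have arith (a b c d e : R) : 0 <= e -> a <= c * b * d -> a * e <= c * b * e * d.
  by move=> e0 h; have := ler_wpM2r e0 h; congr (_ <= _); ring.
by apply: arith; [exact: grad_norm_ge0|exact: nG].
Qed.

#[local] Opaque conv.

(** Both arguments of the form change, and the part [aST w t t] of the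
    difference, with [t] the difference of the temperatures, vanishes by skew
    symmetry. *)
Lemma aSTB_skew (v w : vector_field R) T T' : vbounded_H10 v -> vbounded_H10 w -> bounded_H10 T -> bounded_H10 T' ->
  aST A v T (fun x => T x - T' x) - aST A w T' (fun x => T x - T' x) =
  aST A (fun i x => v i x - w i x) T (fun x => T x - T' x).
Proof.
move=> hv hw hT hT'; have ht := bounded_H10B hT hT'.
rewrite !aST_conv//; last exact: vbounded_H10B.
rewrite !convBl// !(convBr (S := T) (S' := T'))// !(convBm (T := T) (T' := T'))//.
have skew (a b c d e l m k : R) : k * (a - b - (a - c)) - k * (d - e - (l - e)) =
  k * (a - b - (m - l) - (a - c - (m - d))) by ring.
exact: skew.
Qed.

Lemma aSN_aST (u v w : vector_field R) : vbounded_H10 u -> vbounded_H10 v -> vbounded_H10 w ->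
  aSN A u v w = \sum_i aST A u (v i) (w i).
Proof.
move=> hu hv hw; rewrite /aSN (aN_conv hu hv hw) (aN_conv hu hw hv) -sumrB mulr_sumr.
by apply: eq_bigr => i _; rewrite (aST_conv hu (hv i) (hw i)).
Qed.

Lemma aSNB_skew (u v : vector_field R) : vbounded_H10 u -> vbounded_H10 v ->
  let w := fun i x => u i x - v i x in
  aSN A u u w - aSN A v v w = aSN A w u w.
Proof.
move=> hu hv w; have hw : vbounded_H10 w by exact: vbounded_H10B.
rewrite (aSN_aST hu hu hw) (aSN_aST hv hv hw) (aSN_aST hw hu hw) -sumrB.
by apply: eq_bigr => i _; exact: aSTB_skew.
Qed.

Lemma aST_self (v : vector_field R) T : aST A v T T = 0.
Proof.
rewrite /aST (_ : Rintegral _ _ _ = \int[leb2]_(x in A) 0).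
  by rewrite Rintegral_cst// mul0r mulr0.
by apply: eq_Rintegral => x _; rewrite subrr.
Qed.

Lemma aSN_self (u v : vector_field R) : aSN A u v v = 0.
Proof. by rewrite /aSN subrr mulr0. Qed.

Lemma aST_bound C (v : vector_field R) T S : is_embedding_const A 4 C ->
  vbounded_H10 v -> bounded_H10 T -> bounded_H10 S ->
  `|aST A v T S| <= C ^+ 2 * vgrad_norm A 2 v * grad_norm A 2 T * grad_norm A 2 S.
Proof.
move=> hC hv hT hS; rewrite aST_conv//.
have arith (a b c d e : R) : `|a| <= c * d * e -> `|b| <= c * e * d -> `|2^-1 * (a - b)| <= c * d * e.
  rewrite mulrAC => ha hb; rewrite normrM ger0_norm// ?invr_ge0//.
  by have := ler_normB a b; move: ha hb; lra.
exact: arith (conv_bound hC hv hT hS) (conv_bound hC hv hS hT).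
Qed.

Lemma aSN_bound CN (u w : vector_field R) : is_convection_const A CN ->
  vH10 A u -> vH10 A w ->
  `|aSN A w u w| <= CN * vgrad_norm A 2 u * vgrad_norm A 2 w ^+ 2.
Proof.
move=> [CN0 hCN] hu hw; rewrite /aSN.
have h1 := hCN _ _ _ hw hu hw; have h2 := hCN _ _ _ hw hw hu.
have arith (a b c d e : R) : `|a| <= c * e * d * e -> `|b| <= c * e * e * d ->
    `|2^-1 * (a - b)| <= c * d * e ^+ 2.
  move=> ha hb; rewrite normrM ger0_norm// ?invr_ge0//.
  have -> : c * d * e ^+ 2 = 2^-1 * (c * e * d * e + c * e * e * d) by field.
  by rewrite ler_wpM2l ?invr_ge0// (le_trans (ler_normB a b))// lerD.
exact: arith h1 h2.
Qed.

End ConvectionForms.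

(** * Energy estimates *)

Section Arithmetic.
Context {R : realType}.

Lemma le_of_sqr_le (m a b : R) : 0 <= a -> 0 <= b -> m * a ^+ 2 <= b * a -> m * a <= b.
Proof.
move=> a0 b0; have [->|a1] := eqVneq a 0; first by rewrite !mulr0.
have ap : 0 < a by rewrite lt_def a1.
by rewrite expr2 mulrA ler_pM2r.
Qed.

(** Two weak formulations, tested with the difference of the solutions, are
    subtracted. Per equation, [a] is the diffusion term, [s] the convection term,
    and [x] and [y] are monotone terms. The difference of the diffusion terms
    splits into a coercive part [b2] and a perturbation [b1]. *)
Lemma energy_balance (a1 a2 s1 s2 x1 x2 y1 y2 l b1 b2 b3 q y z : R) :
  a1 + x1 + s1 + y1 = l -> a2 + x2 + s2 + y2 = l -> x2 <= x1 -> y2 <= y1 ->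
  a1 - a2 = b1 + b2 -> s1 - s2 = b3 -> `|b1| <= y -> `|b3| <= z -> q <= b2 -> q <= y + z.
Proof.
move=> h1 h2 h3 h4 h5 h6 h7 h8 h9.
have := ler_norm (- b1); have := ler_norm (- b3); rewrite !normrN; lra.
Qed.

End Arithmetic.

Section EnergyEstimates.
Context {R : realType}.
Implicit Types (u v t T S : scalar_field R) (i j : 'I_2).
Context {A : set (plane R)}.
Hypothesis oA : open A.
Hypothesis bA : bounded_set A.
Let mA : measurable (A : set (mplane R)) := open_measurable_plane oA.

Lemma gdotB_ae u v z : H10 A u -> H10 A v -> \forall x \ae leb2, A x ->
  gdot (A := A) (fun x => u x - v x) z x = gdot (A := A) u z x - gdot (A := A) v z x.
Proof.
move=> hu hv; apply: ae_leb2_imp (H10B_wderiv oA hu hv) => x h Ax.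
by rewrite /gdot -sumrB; apply: eq_bigr => j _; rewrite h// mulrBl.
Qed.

Lemma vgdotB_ae (u v z : vector_field R) : vH10 A u -> vH10 A v -> \forall x \ae leb2, A x ->
  vgdot (A := A) (fun i x => u i x - v i x) z x = vgdot (A := A) u z x - vgdot (A := A) v z x.
Proof.
move=> hu hv; apply: ae_leb2_imp (vH10B_wderiv oA hu hv) => x h Ax.
rewrite /vgdot -sumrB; apply: eq_bigr => i _; rewrite -sumrB.
by apply: eq_bigr => j _; rewrite h// mulrBl.
Qed.

Lemma Rintegral_coefficientB (c1 c2 X1 X2 Z : scalar_field R) :
  bounded_fun (A := A) c1 -> bounded_fun (A := A) c2 ->
  integrable_on A X1 -> integrable_on A X2 -> integrable_on A Z ->
  (\forall x \ae leb2, A x -> Z x = X1 x - X2 x) ->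
  \int[leb2]_(x in A) (c1 x * X1 x) - \int[leb2]_(x in A) (c2 x * X2 x) =
  \int[leb2]_(x in A) ((c1 x - c2 x) * X1 x) + \int[leb2]_(x in A) (c2 x * Z x).
Proof.
move=> b1 b2 i1 i2 iZ hZ.
have b12 : bounded_fun (A := A) (fun x => c1 x - c2 x) by exact: bounded_funD (bounded_funN b2).
have j11 := bounded_funM_integrable oA b1 i1.
have j22 := bounded_funM_integrable oA b2 i2.
have j12 := bounded_funM_integrable oA b12 i1.
have jZ := bounded_funM_integrable oA b2 iZ.
rewrite -RintegralB// -RintegralD//.
apply: (eq_ae_Rintegral mA).
- exact: (integrable_on_measurable (integrable_onB mA j11 j22)).
- exact: (integrable_on_measurable (integrable_onD mA j12 jZ)).
- apply: ae_leb2_imp hZ => x h Ax; rewrite h//; ring.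
Qed.

Lemma temperature_apriori (c : scalar_field R) (m : R) (g : scalar_field R -> R) T :
  bounded_fun (A := A) c -> (forall x, A x -> m <= c x) -> Hm1 A g -> H10 A T ->
  \int[leb2]_(x in A) (c x * gdot (A := A) T T x) = g T ->
  m * grad_norm A 2 T <= Hm1_norm A g.
Proof.
move=> bc mc hg hT heq.
have h1 := Rintegral_coercive oA bc mc (H10_grad_abs oA hT).
have h2 := le_trans (ler_norm _) (le_Hm1_norm hg hT).
apply: le_of_sqr_le (grad_norm_ge0 _ _) (Hm1_norm_ge0 _) _.
apply: le_trans h2; rewrite -heq; apply: le_trans h1 _.
rewrite le_eqVlt; apply/orP; left; apply/eqP; apply: eq_Rintegral => x _.
by rewrite gdot_self.
Qed.

(** The heat equations of the two solutions, tested with the difference of the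
    temperatures. *)
Lemma temperature_difference (k : R -> R) (L m M C C4 eps : R) (g : scalar_field R -> R)
    (u1 u2 : vector_field R) T1 T2 :
  let t := fun x => T1 x - T2 x in let w := fun i x => u1 i x - u2 i x in
  L.-lipschitz k -> (forall r, m <= k r <= M) -> 0 < m -> 0 < eps ->
  is_embedding_const A (2 * (2 + eps) / eps) C -> is_embedding_const A 4 C4 ->
  vbounded_H10 (A := A) u1 -> vbounded_H10 (A := A) u2 ->
  bounded_H10 (A := A) T1 -> bounded_H10 (A := A) T2 -> W1p A (2 + eps) T1 ->
  \int[leb2]_(x in A) (k (T1 x) * gdot (A := A) T1 t x) + aST A u1 T1 t = g t ->
  \int[leb2]_(x in A) (k (T2 x) * gdot (A := A) T2 t x) + aST A u2 T2 t = g t ->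
  m * grad_norm A 2 t ^+ 2 <=
    L * C * grad_norm A (2 + eps) T1 * grad_norm A 2 t * grad_norm A 2 t +
    C4 ^+ 2 * vgrad_norm A 2 w * grad_norm A 2 T1 * grad_norm A 2 t.
Proof.
move=> t w Lk mk m0 e0 hC hC4 hu1 hu2 hT1 hT2 WT1 eq1 eq2.
have ht : bounded_H10 (A := A) t by exact: bounded_H10B.
have hw : vbounded_H10 (A := A) w by exact: vbounded_H10B.
have bk1 : bounded_fun (A := A) (k \o T1).
  by apply: lipschitz_bounded_comp Lk mk m0 _; case: hT1.2.
have bk2 : bounded_fun (A := A) (k \o T2).
  by apply: lipschitz_bounded_comp Lk mk m0 _; case: hT2.2.
have i1 := gdot_integrable oA hT1.1 ht.1; have i2 := gdot_integrable oA hT2.1 ht.1.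
have itt := gdot_integrable oA ht.1 ht.1.
have D := Rintegral_coefficientB bk1 bk2 i1 i2 itt (gdotB_ae t hT1.1 hT2.1).
have E := aSTB_skew oA bA hu1 hu2 hT1 hT2.
have B := aST_bound oA bA hC4 hw hT1 ht.
have e2 : 0 < 2 + eps by rewrite addr_gt0.
have b12 : bounded_fun (A := A) (fun x => k (T1 x) - k (T2 x)).
  exact: bounded_funD (bounded_funN bk2).
have P := lipschitz_coefficient_bound oA e0 hC (lipschitz_ge0 Lk) ht.1 (grad_absE oA e2 WT1)
  (H10_grad_abs oA ht.1) (bounded_funM_integrable oA b12 i1).
have {}P := P (fun x _ => lipschitz_dist Lk (T1 x) (T2 x)).
have cs x : A x -> `|gdot (A := A) T1 t x| <= `|grad_abs A T1 x| * `|grad_abs A t x|.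
  by move=> _; rewrite !(ger0_norm (grad_abs_ge0 _ _)); exact: gdot_le.
have {}P := P cs.
have Q : m * grad_norm A 2 t ^+ 2 <= \int[leb2]_(x in A) ((k \o T2) x * gdot (A := A) t t x).
  apply: le_trans (Rintegral_coercive oA bk2 _ (H10_grad_abs oA ht.1)) _.
    by move=> x _ /=; case/andP: (mk (T2 x)).
  rewrite le_eqVlt; apply/orP; left; apply/eqP; apply: eq_Rintegral => x _.
  by rewrite gdot_self.
(* The heat equation has no monotone terms. *)
rewrite -[X in X + _]addr0 -[LHS]addr0 in eq1; rewrite -[X in X + _]addr0 -[LHS]addr0 in eq2.
exact: energy_balance eq1 eq2 (lexx 0) (lexx 0) D E P B Q.
Qed.

(** [q] and [r] stand for the zero-order term and the Forchheimer term, both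
    tested with the velocity itself. *)
Lemma velocity_apriori (c q r : scalar_field R) (m : R) (f : vector_field R -> R) (u : vector_field R) :
  bounded_fun (A := A) c -> (forall x, A x -> m <= c x) -> vHm1 A f -> vH10 A u ->
  integrable_on A q -> (forall x, A x -> 0 <= q x) -> (forall x, A x -> 0 <= r x) ->
  \int[leb2]_(x in A) (c x * vgdot (A := A) u u x + q x) + \int[leb2]_(x in A) r x = f u ->
  m * vgrad_norm A 2 u <= vHm1_norm A f.
Proof.
move=> bc mc hf hu iq q0 r0 heq.
have h1 := Rintegral_coercive oA bc mc (vH10_vgrad_abs oA hu).
have h2 := le_trans (ler_norm _) (le_vHm1_norm hf hu).
apply: le_of_sqr_le (vgrad_norm_ge0 _ _) (vHm1_norm_ge0 _) _.
apply: le_trans h2; rewrite -heq RintegralD//; last first.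
  exact: (bounded_funM_integrable oA bc (vgdot_integrable oA hu hu)).
have q1 := Rintegral_ge0 leb2 q0; have r1 := Rintegral_ge0 leb2 r0.
rewrite -addrA; apply: le_trans h1 _; rewrite -[leLHS]addr0; apply: lerD; last exact: addr_ge0.
rewrite le_eqVlt; apply/orP; left; apply/eqP; apply: eq_Rintegral => x _.
by rewrite vgdot_self.
Qed.

(** The momentum equations of the two solutions, tested with the difference of
    the velocities. The terms [q] and [r] are the zero-order and the Forchheimer
    terms, of which only the monotonicity matters. *)
Lemma velocity_difference (k : R -> R) (L m M C CN eps : R)
    (u1 u2 : vector_field R) T1 T2 (q1 q2 r1 r2 : scalar_field R) (fw : R) :
  let t := fun x => T1 x - T2 x in let w := fun i x => u1 i x - u2 i x in
  L.-lipschitz k -> (forall r, m <= k r <= M) -> 0 < m -> 0 < eps ->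
  is_embedding_const A (2 * (2 + eps) / eps) C -> is_convection_const A CN ->
  vbounded_H10 (A := A) u1 -> vbounded_H10 (A := A) u2 ->
  bounded_H10 (A := A) T1 -> bounded_H10 (A := A) T2 -> vW1p A (2 + eps) u1 ->
  integrable_on A q1 -> integrable_on A q2 -> integrable_on A r1 -> integrable_on A r2 ->
  (forall x, A x -> q2 x <= q1 x) -> (forall x, A x -> r2 x <= r1 x) ->
  \int[leb2]_(x in A) (k (T1 x) * vgdot (A := A) u1 w x + q1 x) + aSN A u1 u1 w +
    \int[leb2]_(x in A) r1 x = fw ->
  \int[leb2]_(x in A) (k (T2 x) * vgdot (A := A) u2 w x + q2 x) + aSN A u2 u2 w +
    \int[leb2]_(x in A) r2 x = fw ->
  m * vgrad_norm A 2 w ^+ 2 <=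
    L * C * vgrad_norm A (2 + eps) u1 * grad_norm A 2 t * vgrad_norm A 2 w +
    CN * vgrad_norm A 2 u1 * vgrad_norm A 2 w ^+ 2.
Proof.
move=> t w Lk mk m0 e0 hC hCN hu1 hu2 hT1 hT2 Wu1 iq1 iq2 ir1 ir2 q12 r12.
have ht : bounded_H10 (A := A) t by exact: bounded_H10B.
have hw : vbounded_H10 (A := A) w by exact: vbounded_H10B.
have bk1 : bounded_fun (A := A) (k \o T1).
  by apply: lipschitz_bounded_comp Lk mk m0 _; case: hT1.2.
have bk2 : bounded_fun (A := A) (k \o T2).
  by apply: lipschitz_bounded_comp Lk mk m0 _; case: hT2.2.
have vu1 := vbounded_vH10 hu1; have vu2 := vbounded_vH10 hu2; have vw := vbounded_vH10 hw.
have i1 := vgdot_integrable oA vu1 vw; have i2 := vgdot_integrable oA vu2 vw.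
have iww := vgdot_integrable oA vw vw.
have j1 := bounded_funM_integrable oA bk1 i1; have j2 := bounded_funM_integrable oA bk2 i2.
rewrite (RintegralD mA j1 iq1) (RintegralD mA j2 iq2) => eq1 eq2.
have D := Rintegral_coefficientB bk1 bk2 i1 i2 iww (vgdotB_ae w vu1 vu2).
have E := aSNB_skew oA bA hu1 hu2.
have B := aSN_bound hCN vu1 vw.
have e2 : 0 < 2 + eps by rewrite addr_gt0.
have b12 : bounded_fun (A := A) (fun x => k (T1 x) - k (T2 x)).
  exact: bounded_funD (bounded_funN bk2).
have P := lipschitz_coefficient_bound oA e0 hC (lipschitz_ge0 Lk) ht.1 (Lp_vgrad_abs oA e2 Wu1)
  (vH10_vgrad_abs oA vw) (bounded_funM_integrable oA b12 i1).
have {}P := P (fun x _ => lipschitz_dist Lk (T1 x) (T2 x)).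
have cs x : A x -> `|vgdot (A := A) u1 w x| <= `|vgrad_abs A u1 x| * `|vgrad_abs A w x|.
  by move=> _; rewrite !(ger0_norm (vgrad_abs_ge0 _ _)); exact: vgdot_le.
have {}P := P cs.
have Q : m * vgrad_norm A 2 w ^+ 2 <= \int[leb2]_(x in A) ((k \o T2) x * vgdot (A := A) w w x).
  apply: le_trans (Rintegral_coercive oA bk2 _ (vH10_vgrad_abs oA vw)) _.
    by move=> x _ /=; case/andP: (mk (T2 x)).
  rewrite le_eqVlt; apply/orP; left; apply/eqP; apply: eq_Rintegral => x _.
  by rewrite vgdot_self.
have q12' := le_Rintegral mA iq2 iq1 q12; have r12' := le_Rintegral mA ir2 ir1 r12.
exact: energy_balance eq1 eq2 q12' r12' D E P B Q.
Qed.

(** A finite embedding constant replaces the Poincaré inequality. *)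
Lemma eq0_of_grad_norm p C u : 0 < p -> is_embedding_const A p C -> H10 A u ->
  {within closure A, continuous u} -> grad_norm A 2 u = 0 ->
  forall x, closure A x -> u x = 0.
Proof.
move=> p0 hC hu cu u0; apply: ae_eq0_closure => //.
have [Lu] := embedding_Lp hC hu; rewrite u0 mulr0 => nu.
have {}nu : Lp_norm A p u = 0 by apply/eqP; rewrite eq_le nu Lp_norm_ge0.
have I0 := Lp_norm_powE p0 Lu; rewrite nu powR0 ?gt_eqF// in I0.
have := ae_eq0_of_Rintegral mA (Lp_integrable p0 Lu) (fun x _ => powR_ge0 _ _) (esym I0).
by apply: ae_leb2_imp => x h /h /eqP; rewrite powR_eq0 normr_eq0 => /andP[/eqP].
Qed.

End EnergyEstimates.

(** * Uniqueness *)

Section Smallness.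
Context {R : realType}.

(** Writing [al] and [be] for the two powers, the difference of the two sides is
    half of [(al + be) |a - b|^2 + (al - be) (|a|^2 - |b|^2)]. *)
Lemma enorm_powR_monotone (r : R) (a b : 'I_2 -> R) : 0 <= r ->
  enorm b `^ r * \sum_i b i * (a i - b i) <= enorm a `^ r * \sum_i a i * (a i - b i).
Proof.
move=> r0; set al := enorm a `^ r; set be := enorm b `^ r.
have al0 : 0 <= al by exact: powR_ge0.
have be0 : 0 <= be by exact: powR_ge0.
have mono : 0 <= (al - be) * (enorm a ^+ 2 - enorm b ^+ 2).
  have [ab|ba] := leP (enorm a) (enorm b).
    rewrite mulr_le0// subr_le0; first by apply: ge0_ler_powR; rewrite ?nnegrE ?enorm_ge0.
    by rewrite lerXn2r ?nnegrE ?enorm_ge0.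
  rewrite mulr_ge0// subr_ge0; first by apply: ge0_ler_powR; rewrite ?nnegrE ?enorm_ge0// ltW.
  by rewrite lerXn2r ?nnegrE ?enorm_ge0// ltW.
have sq : 0 <= (al + be) * \sum_i (a i - b i) ^+ 2.
  by rewrite mulr_ge0 ?addr_ge0// sumr_ge0// => i _; exact: sqr_ge0.
move: mono sq; rewrite !enorm_sqr !big_ord_recl !big_ord0 !addr0.
move: (a ord0) (a (lift ord0 ord0)) (b ord0) (b (lift ord0 ord0)) => a0 a1 b0 b1 mono sq.
rewrite -subr_ge0.
rewrite (_ : _ - _ = 2^-1 * ((al - be) * (a0 ^+ 2 + a1 ^+ 2 - (b0 ^+ 2 + b1 ^+ 2)) +
  (al + be) * ((a0 - b0) ^+ 2 + (a1 - b1) ^+ 2))); last by field.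
by rewrite mulr_ge0 ?invr_ge0// addr_ge0.
Qed.

(** Here [x] and [y] are the gradient norms of the differences of the temperatures
    and of the velocities, [a] and [b] those of the first temperature and
    velocity in [L2], [gT] and [gu] those in the space with exponent [2 + eps].
    The temperature inequality bounds [x] by a multiple of [y]; inserted into the
    velocity inequality it leaves [y] times a number smaller than 1 on the
    right. *)
Lemma smallness_forces_zero (num kapm CN Lnu Lkappa Ceps C42 F G gu gT a b x y : R) :
  0 < num -> 0 < kapm -> 0 < CN -> 0 <= Lnu -> 0 <= Ceps -> 0 <= gu -> 0 <= a -> 0 <= b -> 0 <= x -> 0 <= y ->
  CN / num ^+ 2 * F + (Lnu * Ceps * C42 ^+ 2 * G * gu) /
    (num * kapm * (kapm - Lkappa * Ceps * gT)) < 1 ->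
  Lkappa * Ceps * gT < kapm ->
  kapm * a <= G -> num * b <= F ->
  kapm * x ^+ 2 <= Lkappa * Ceps * gT * x * x + C42 ^+ 2 * y * a * x ->
  num * y ^+ 2 <= Lnu * Ceps * gu * x * y + CN * b * y ^+ 2 ->
  x = 0 /\ y = 0.
Proof.
move=> num0 kapm0 CN0 Lnu0 Ceps0 gu0 a0 b0 x0 y0 small smallT aG bF hx hy.
set d := kapm - Lkappa * Ceps * gT in small.
have d0 : 0 < d by rewrite subr_gt0.
have {}hx : d * x <= C42 ^+ 2 * y * a.
  apply: le_of_sqr_le => //; first by do 2 apply: mulr_ge0 => //; exact: sqr_ge0.
  by rewrite mulrBl; lra.
have {}hy : num * y <= Lnu * Ceps * gu * x + CN * b * y.
  apply: le_of_sqr_le => //; first by rewrite addr_ge0 ?mulr_ge0// ltW.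
  by rewrite mulrDl -[_ * y * y]mulrA -expr2.
have kx : kapm * d * x <= C42 ^+ 2 * y * G.
  have h : C42 ^+ 2 * y * (kapm * a) <= C42 ^+ 2 * y * G by rewrite ler_wpM2l// mulr_ge0// sqr_ge0.
  apply: le_trans h; rewrite (_ : C42 ^+ 2 * y * (kapm * a) = kapm * (C42 ^+ 2 * y * a)); last by ring.
  by rewrite -mulrA ler_wpM2l// ltW.
have {small}small : CN * F * kapm * d + Lnu * Ceps * C42 ^+ 2 * G * gu * num < num ^+ 2 * kapm * d.
  have nz : [/\ num != 0, kapm != 0 & d != 0] by rewrite !gt_eqF.
  have den : 0 < num ^+ 2 * kapm * d by rewrite !mulr_gt0// exprn_gt0.
  move: small; rewrite (_ : _ + _ = (CN * F * kapm * d + Lnu * Ceps * C42 ^+ 2 * G * gu * num) /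
    (num ^+ 2 * kapm * d)); first by rewrite ltr_pdivrMr// mul1r.
  by case: nz => n1 n2 n3; field; rewrite n1 n2 n3.
have yz : y = 0.
  apply/eqP; rewrite eq_le y0 andbT leNgt; apply/negP => yp.
  have nkd : 0 <= num * kapm * d by rewrite !mulr_ge0// ltW.
  have h1 := ler_wpM2l nkd hy.
  have h2 : Lnu * Ceps * gu * num * (kapm * d * x) <= Lnu * Ceps * gu * num * (C42 ^+ 2 * y * G).
    by rewrite ler_wpM2l// !mulr_ge0// ltW.
  have h3 : CN * kapm * d * y * (num * b) <= CN * kapm * d * y * F.
    by rewrite ler_wpM2l// !mulr_ge0// ltW.
  have h4 : (CN * F * kapm * d + Lnu * Ceps * C42 ^+ 2 * G * gu * num) * y < num ^+ 2 * kapm * d * y.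
    by rewrite ltr_pM2r.
  suff : num ^+ 2 * kapm * d * y <= (CN * F * kapm * d + Lnu * Ceps * C42 ^+ 2 * G * gu * num) * y.
    by rewrite leNgt h4.
  have -> : num ^+ 2 * kapm * d * y = num * kapm * d * (num * y) by ring.
  apply: le_trans h1 _.
  have -> : num * kapm * d * (Lnu * Ceps * gu * x + CN * b * y) =
    Lnu * Ceps * gu * num * (kapm * d * x) + CN * kapm * d * y * (num * b) by ring.
  apply: le_trans (lerD h2 h3) _; rewrite le_eqVlt; apply/orP; left; apply/eqP; ring.
split => //; move: hx; rewrite yz mulr0 mul0r => dx.
by apply/eqP; rewrite eq_le x0 andbT -(pmulr_rle0 _ d0).
Qed.

End Smallness.

Section Pressure.
Context {R : realType}.
Context {A : set (plane R)}.
Hypothesis oA : open A.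
Hypothesis bA : bounded_set A.
Let mA : measurable (A : set (mplane R)) := open_measurable_plane oA.

Lemma div_Lp2 (v : vector_field R) : vH10 A v -> Lp A 2 (div A v).
Proof. by move=> hv; apply: (Lp2_sum oA) => i; exact: H10_Lp2. Qed.

Lemma mul_div_integrable p (v : vector_field R) : bounded_fun (A := A) p -> vH10 A v ->
  integrable_on A (fun x => p x * div A v x).
Proof.
move=> bp hv; apply: (bounded_funM_integrable oA) => //.
by apply: (Lp2_integrable1 oA bA); exact: div_Lp2.
Qed.

Lemma Rintegral_mul_divB p (u v : vector_field R) : bounded_fun (A := A) p ->
  vH10 A u -> vH10 A v ->
  \int[leb2]_(x in A) (p x * div A (fun i x => u i x - v i x) x) =
  \int[leb2]_(x in A) (p x * div A u x) - \int[leb2]_(x in A) (p x * div A v x).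
Proof.
move=> bp hu hv; have iu := mul_div_integrable bp hu; have iv := mul_div_integrable bp hv.
rewrite -RintegralB//; apply: (eq_ae_Rintegral mA).
- exact: (integrable_on_measurable (mul_div_integrable bp (vH10B oA hu hv))).
- exact: (integrable_on_measurable (integrable_onB mA iu iv)).
apply: ae_leb2_imp (vH10B_wderiv oA hu hv) => x h Ax.
rewrite -mulrBr; congr (_ * _); rewrite /div -sumrB.
by apply: eq_bigr => i _; rewrite h.
Qed.

Lemma bounded_enorm_powR (u : vector_field R) (r : R) : 0 <= r ->
  (forall i, bounded_fun (A := A) (u i)) ->
  bounded_fun (A := A) (fun x => enorm (u ^~ x) `^ r).
Proof.
move=> r0 bu; have [msq [M hM]] : bounded_fun (A := A) (fun x => \sum_i u i x * u i x).
  by apply: bounded_fun_sum => i; exact: bounded_funM.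
have E x : enorm (u ^~ x) = Num.sqrt (\sum_i u i x * u i x).
  by congr Num.sqrt; apply: eq_bigr => i _; rewrite expr2.
have men : measurable_fun A (fun x => enorm (u ^~ x)).
  by rewrite (funext E); exact: measurable_sqrt_comp.
split.
  by apply: (@measurableT_comp _ _ _ _ _ _ (fun t : R => t `^ r)).
exists (Num.sqrt M `^ r) => x Ax; rewrite ger0_norm ?powR_ge0//.
apply: ge0_ler_powR; rewrite ?nnegrE ?enorm_ge0 ?sqrtr_ge0//.
by rewrite E ler_wsqrtr// (le_trans (ler_norm _))// hM.
Qed.

(** If [q] did not vanish, all quotients of the inf-sup condition for [q] would
    be 0, below [beta]. *)
Lemma inf_sup_injective (beta : R) fe T q : 0 < beta -> inf_sup beta fe A T -> Mh A T q ->
  (forall v, Xh fe A T v -> \int[leb2]_(x in A) (q x * div A v x) = 0) ->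
  forall x, closure A x -> q x = 0.
Proof.
move=> b0 his hq q0 x cAx; apply/eqP; apply: contrapT => /negP qx.
move: his; rewrite /inf_sup => his.
have : (beta%:E <= 0)%E.
  apply: le_trans his _; apply: le_trans.
    by apply: ereal_inf_lbound; exists q => //; split => //; exists x.
  by apply: ge_ereal_sup => _ [v [Xv _] <-]; rewrite q0// mul0r.
by rewrite lee_fin leNgt b0.
Qed.

Lemma aN_ext (u u' v v' w w' : vector_field R) : (forall i, {in A, u i =1 u' i}) ->
  (forall i, {in A, v i =1 v' i}) -> (forall i, {in A, w i =1 w' i}) -> aN A u v w = aN A u' v' w'.
Proof.
move=> hu hv hw; apply: eq_Rintegral => x xA; apply: eq_bigr => i _.
rewrite (hw i x xA); congr (_ * _); apply: eq_bigr => j _.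
by rewrite (hu j x xA) (wderiv_ext j (hv i)).
Qed.

(** Once velocities and temperatures agree, all the other terms of the two momentum
    equations cancel. *)
Lemma discrete_pressure_orthogonal (fe : fe_pair R) Th (s : R) (nu kappa : R -> R) f g
    (u1 u2 : vector_field R) (p1 p2 T1 T2 : scalar_field R) :
  discrete_solution A fe Th s nu kappa f g u1 p1 T1 ->
  discrete_solution A fe Th s nu kappa f g u2 p2 T2 ->
  (forall i, {in A, u1 i =1 u2 i}) -> {in A, T1 =1 T2} ->
  forall v, Xh fe A Th v -> \int[leb2]_(x in A) ((p1 x - p2 x) * div A v x) = 0.
Proof.
move=> [_ Mp1 _ [eqm1 _ _]] [_ Mp2 _ [eqm2 _ _]] uin Tin v Xv; have [_ _ hv] := Xv.
have ip1 := mul_div_integrable (Mh_bounded bA Mp1) hv.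
have ip2 := mul_div_integrable (Mh_bounded bA Mp2) hv.
rewrite (_ : Rintegral _ _ _ = \int[leb2]_(x in A) (p1 x * div A v x) -
  \int[leb2]_(x in A) (p2 x * div A v x)); last first.
  by rewrite -RintegralB//; apply: eq_Rintegral => x _; rewrite mulrBl.
have E1 : \int[leb2]_(x in A)
    (nu (T1 x) * (\sum_i \sum_j wderiv A j (u1 i) x * wderiv A j (v i) x) +
     \sum_i u1 i x * v i x) =
  \int[leb2]_(x in A)
    (nu (T2 x) * (\sum_i \sum_j wderiv A j (u2 i) x * wderiv A j (v i) x) +
     \sum_i u2 i x * v i x).
  apply: eq_Rintegral => x xA; rewrite Tin//; congr (_ * _ + _).
    by apply: eq_bigr => i _; apply: eq_bigr => j _; rewrite (wderiv_ext j (uin i)).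
  by apply: eq_bigr => i _; rewrite uin.
have E2 : aSN A u1 u1 v = aSN A u2 u2 v.
  have vr i : {in A, v i =1 v i} by [].
  by rewrite /aSN (aN_ext uin uin vr) (aN_ext uin vr uin).
have E3 : \int[leb2]_(x in A) (enorm (u1 ^~ x) `^ (s - 2) * \sum_i u1 i x * v i x) =
    \int[leb2]_(x in A) (enorm (u2 ^~ x) `^ (s - 2) * \sum_i u2 i x * v i x).
  apply: eq_Rintegral => x xA; congr (enorm _ `^ _ * _).
    by apply/funext => i; rewrite uin.
  by apply: eq_bigr => i _; rewrite uin.
have := eqm1 v Xv; rewrite E1 E2 E3 -(eqm2 v Xv) => /addrI/oppr_inj ->.
by rewrite subrr.
Qed.

End Pressure.

Theorem theorem4p3 (R : realType) (Omega : set (plane R))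
  (hOmega : bounded_lipschitz_polytope Omega)
  (s : R) (hs : 3 <= s <= 4)
  (nu kappa : R -> R) (Lnu Lkappa num nup kapm kapp : R)
  (hLnu : Lnu.-lipschitz nu) (hLkappa : Lkappa.-lipschitz kappa)
  (hnum : 0 < num) (hnup : 0 < nup) (hkapm : 0 < kapm) (hkapp : 0 < kapp)
  (hnu : forall r, num <= nu r <= nup)
  (hkappa : forall r, kapm <= kappa r <= kapp)
  (f : vector_field R -> R) (hf : vHm1 Omega f)
  (g : scalar_field R -> R) (hg : Hm1 Omega g)
  (T0 : set (set (plane R))) (TT : set (set (set (plane R))))
  (hTT : mesh_family Omega T0 TT)
  (fe : fe_pair R) (hfe : admissible_pair fe TT)
  (beta : R) (hbeta : 0 < beta)
  (hinfsup : forall T, TT T -> inf_sup beta fe Omega T)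
  (CN : R) (hCN : is_convection_const Omega CN)
  (C42 : R) (hC42 : is_best_embedding_const Omega 4 C42)
  (eps : R) (heps : 0 < eps)
  (Ceps : R)
  (hCeps : is_best_embedding_const Omega (2 * (2 + eps) / eps) Ceps)
  (Th : set (set (plane R))) (hTh : TT Th)
  (u1 : vector_field R) (p1 T1 : scalar_field R)
  (hsol1 : discrete_solution Omega fe Th s nu kappa f g u1 p1 T1)
  (hu1 : vW1p Omega (2 + eps) u1) (hT1 : W1p Omega (2 + eps) T1)
  (hsmall : CN / num ^+ 2 * vHm1_norm Omega f +
      (Lnu * Ceps * C42 ^+ 2 * Hm1_norm Omega g *
         vgrad_norm Omega (2 + eps) u1) /
      (num * kapm * (kapm - Lkappa * Ceps * grad_norm Omega (2 + eps) T1))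
      < 1)
  (hsmallT : Lkappa * Ceps * grad_norm Omega (2 + eps) T1 < kapm)
  (u2 : vector_field R) (p2 T2 : scalar_field R)
  (hsol2 : discrete_solution Omega fe Th s nu kappa f g u2 p2 T2) :
  forall x, closure Omega x ->
    [/\ forall i, u2 i x = u1 i x, p2 x = p1 x & T2 x = T1 x].
Proof.
have [oA bA _ _] := hOmega.
have [Xu1 Mp1 YT1 [eqm1 eqd1 eqt1]] := hsol1.
have [Xu2 Mp2 YT2 [eqm2 eqd2 eqt2]] := hsol2.
have bu1 : vbounded_H10 (A := Omega) u1.
  by move=> i; split; [case: Xu1|exact: (Xh_bounded bA i Xu1)].
have bu2 : vbounded_H10 (A := Omega) u2.
  by move=> i; split; [case: Xu2|exact: (Xh_bounded bA i Xu2)].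
have bT1 : bounded_H10 (A := Omega) T1 by split; [case: YT1|exact: (Yh_bounded bA YT1)].
have bT2 : bounded_H10 (A := Omega) T2 by split; [case: YT2|exact: (Yh_bounded bA YT2)].
pose t := fun x => T1 x - T2 x; pose w := fun i x => u1 i x - u2 i x.
have Yt : Yh fe Omega Th t := YhB oA YT1 YT2.
have Xw : Xh fe Omega Th w := XhB oA Xu1 Xu2.
have bw : vbounded_H10 (A := Omega) w by exact: vbounded_H10B.
have [hu1' hu2'] := (vbounded_vH10 bu1, vbounded_vH10 bu2).
have e2 : 0 < 2 + eps by rewrite addr_gt0.
have s2 : 0 <= s - 2 by lra.
have bcomp (k : R -> R) (L m M : R) (T : scalar_field R) : L.-lipschitz k ->
    (forall r, m <= k r <= M) -> 0 < m -> bounded_H10 (A := Omega) T ->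
    bounded_fun (A := Omega) (k \o T).
  by move=> Lk mk m0 [_ [mT _]]; exact: lipschitz_bounded_comp Lk mk m0 mT.
have aT : kapm * grad_norm Omega 2 T1 <= Hm1_norm Omega g.
  apply: (temperature_apriori oA (bcomp _ _ _ _ _ hLkappa hkappa hkapm bT1) _ hg bT1.1).
    by move=> x _ /=; case/andP: (hkappa (T1 x)).
  by have := eqt1 _ YT1; rewrite aST_self// addr0.
have bdot (v v' : vector_field R) : vbounded_H10 (A := Omega) v -> vbounded_H10 (A := Omega) v' ->
    bounded_fun (A := Omega) (fun x => \sum_i v i x * v' i x).
  by move=> bv bv'; apply: bounded_fun_sum => i; apply: bounded_funM; [case: (bv i)|case: (bv' i)].
have bforch (v v' : vector_field R) : vbounded_H10 (A := Omega) v -> vbounded_H10 (A := Omega) v' ->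
    bounded_fun (A := Omega) (fun x => enorm (v ^~ x) `^ (s - 2) * \sum_i v i x * v' i x).
  move=> bv bv'; apply: bounded_funM; last exact: bdot.
  by apply: bounded_enorm_powR => // i; case: (bv i).
have aU : num * vgrad_norm Omega 2 u1 <= vHm1_norm Omega f.
  apply: (velocity_apriori oA (bcomp _ _ _ _ _ hLnu hnu hnum bT1) (m := num)
    (q := fun x => \sum_i u1 i x * u1 i x)
    (r := fun x => enorm (u1 ^~ x) `^ (s - 2) * \sum_i u1 i x * u1 i x) _ hf hu1').
  - by move=> x _ /=; case/andP: (hnu (T1 x)).
  - by apply: bounded_fun_integrable => //; exact: bdot.
  - by move=> x _; apply: sumr_ge0 => i _; rewrite -expr2 sqr_ge0.
  - move=> x _; rewrite mulr_ge0 ?powR_ge0//.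
    by apply: sumr_ge0 => i _; rewrite -expr2 sqr_ge0.
  - by have := eqm1 _ Xu1; rewrite aSN_self (eqd1 _ Mp1) subr0 addr0.
have hT := temperature_difference oA bA hLkappa hkappa hkapm heps hCeps.1 hC42.1 bu1 bu2 bT1 bT2 hT1
  (eqt1 t Yt) (eqt2 t Yt).
(* Both velocities are discretely divergence free. *)
have pw (p : scalar_field R) : Mh Omega Th p ->
    \int[leb2]_(x in Omega) (p x * div Omega w x) = 0.
  move=> Mp; rewrite (Rintegral_mul_divB oA bA (Mh_bounded bA Mp) hu1' hu2').
  by rewrite eqd1// eqd2// subrr.
have eqw1 := eqm1 w Xw; have eqw2 := eqm2 w Xw.
rewrite (pw _ Mp1) subr0 in eqw1; rewrite (pw _ Mp2) subr0 in eqw2.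
have hU := velocity_difference oA bA hLnu hnu hnum heps hCeps.1 hCN bu1 bu2 bT1 bT2 hu1
  (bounded_fun_integrable oA bA (bdot u1 w bu1 bw)) (bounded_fun_integrable oA bA (bdot u2 w bu2 bw))
  (bounded_fun_integrable oA bA (bforch u1 w bu1 bw)) (bounded_fun_integrable oA bA (bforch u2 w bu2 bw))
  _ _ eqw1 eqw2.
have {}hU := hU _ (fun x _ => enorm_powR_monotone (u1 ^~ x) (u2 ^~ x) s2).
have dotle x : Omega x -> \sum_i u2 i x * w i x <= \sum_i u1 i x * w i x.
  move=> _; apply: ler_sum => i _; rewrite /w -subr_ge0.
  by rewrite (_ : _ - _ = (u1 i x - u2 i x) ^+ 2) ?sqr_ge0//; ring.
have {}hU := hU dotle.
have [t0 w0] := smallness_forces_zero hnum hkapm hCN.1 (lipschitz_ge0 hLnu) (embedding_const_ge0 hCeps.1)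
  (vgrad_norm_ge0 (2 + eps) u1) (grad_norm_ge0 2 T1) (vgrad_norm_ge0 2 u1)
  (grad_norm_ge0 2 t) (vgrad_norm_ge0 2 w) hsmall hsmallT aT aU hT hU.
have four : 0 < 4 :> R by [].
have eqT x : closure Omega x -> T1 x = T2 x.
  move=> cx; apply/eqP; rewrite -subr_eq0; apply/eqP.
  have [ct _ ht] := Yt.
  exact: (eq0_of_grad_norm oA four hC42.1 ht ct t0).
have eqU i x : closure Omega x -> u1 i x = u2 i x.
  move=> cx; apply/eqP; rewrite -subr_eq0; apply/eqP.
  have [cw _ hw] := Xw.
  suff wi0 : grad_norm Omega 2 (w i) = 0.
    exact: (eq0_of_grad_norm oA four hC42.1 (hw i) (cw i) wi0).
  have := vgrad_norm_sqr oA (vH10_W1p hw); rewrite w0 expr0n/= => /esym/eqP.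
  rewrite psumr_eq0; last by move=> j _; exact: sqr_ge0.
  by move=> /allP/(_ i); rewrite mem_index_enum sqrf_eq0 => /(_ isT)/eqP.
have uin i : {in Omega, u1 i =1 u2 i}.
  by move=> x; rewrite inE => Ax; apply: eqU; exact: subset_closure.
have Tin : {in Omega, T1 =1 T2}.
  by move=> x; rewrite inE => Ax; apply: eqT; exact: subset_closure.
have press x : closure Omega x -> p1 x - p2 x = 0.
  exact: (inf_sup_injective hbeta (hinfsup _ hTh) (MhB oA bA Mp1 Mp2)
    (discrete_pressure_orthogonal oA bA hsol1 hsol2 uin Tin)).
move=> x cx; split; first by move=> i; rewrite eqU.
  by apply/esym/eqP; rewrite -subr_eq0 press.
by rewrite eqT.
Qed.
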